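(* Let $n,k\ge 1$ and fix weights $\bm a=(a_1,\dots,a_n)$ and $\bm b=(b_1,\dots,b_k)$ with $a_i,b_j\ge 0$ and $\sum_{i=1}^n a_i=\sum_{j=1}^k b_j=1$. For $(\bm\alpha,\bm\beta)=((\alpha_1,\dots,\alpha_n),(\beta_1,\dots,\beta_k))\in\mathbb{R}^n\times\mathbb{R}^k$ let $$G_p(z)=\sum_{i=1}^n\frac{a_i}{z-\alpha_i},\qquad G_q(z)=\sum_{j=1}^k\frac{b_j}{z-\beta_j},$$ and let $\Omega_{p,q}\subset\mathbb{C}$ be the set of all $z=x+iy$ ($x,y\in\mathbb{R}$) for which there exist $g\in\mathbb{C}\setminus(\mathbb{R}\cup i\mathbb{R})$ and $m\in\mathbb{R}$ with $$G_p\!\left(x+\frac{m}{g}\right)=g,\qquad G_q\!\left(y+\frac{1-m}{ig}\right)=ig .$$ Then for Lebesgue almost every $(\bm\alpha,\bm\beta)\in\mathbb{R}^n\times\mathbb{R}^k=\mathbb{R}^{n+k}$, the set $\Omega_{p,q}$ lies on a real algebraic curve, i.e. there is a non-zero polynomial $f\in\mathbb{R}[x,y]$ with $f(x,y)=0$ for all $x+iy\in\Omega_{p,q}$. In particular, for such $(\bm\alpha,\bm\beta)$ the polynomial $f(x,y)$ produced by the explicit algorithm described in the context is such a polynomial.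
   Context: The $\alpha_i$ (resp. $\beta_j$) are not assumed distinct. Here $p,q$ are Hermitian, freely independent elements of a tracial von Neumann algebra with spectral measures $\mu_p=\sum_i a_i\delta_{\alpha_i}$, $\mu_q=\sum_j b_j\delta_{\beta_j}$, and $G_p,G_q$ are their Cauchy transforms; only $G_p,G_q$ matter for the statement. Algorithm. Consider the following two polynomials in $\mathbb{C}[g,m,x,y]$: $$P=\prod_{i=1}^n(g(x-\alpha_i)+m)-\sum_{i=1}^n a_i\prod_{s\ne i}(g(x-\alpha_s)+m),$$ $$R=\prod_{j=1}^k(ig(y-\beta_j)+1-m)-\sum_{j=1}^k b_j\prod_{s\neq j}(ig(y-\beta_s)+1-m).$$ Step 1: let $f_1(m,x,y)$ be the resultant of $P$ and $R$ with respect to $g$ (determinant of the $(n+k)\times(n+k)$ Sylvester matrix, $P,R$ being viewed as polynomials in $g$ of degrees $n$ and $k$ with coefficients in $\mathbb{C}[m,x,y]$). Step 2: $f_1$ is divisible by $m^{n-1}(m-1)^{k-1}$; let $f_2=f_1/(m^{n-1}(m-1)^{k-1})\in\mathbb{C}[m,x,y]$. Step 3: let $\mathrm{Re} f_2,\mathrm{Im} f_2\in\mathbb{R}[m,x,y]$ be the polynomials obtained by taking the real (imaginary) parts of $f_2$ assuming $m,x,y\in\mathbb{R}$. Step 4: let $f(x,y)\in\mathbb{R}[x,y]$ be the resultant of $\mathrm{Re} f_2$ and $\mathrm{Im} f_2$ with respect to $m$. Output $f$. *)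

(* Defs.v *)
From HB Require Import structures.
From mathcomp Require Import all_boot all_order all_algebra.
From mathcomp Require Import complex.
From mathcomp Require Import all_classical all_reals all_analysis.

Set Implicit Arguments.
Unset Strict Implicit.
Unset Printing Implicit Defensive.

Import Order.TTheory GRing.Theory Num.Theory.
Import numFieldNormedType.Exports.

Local Open Scope classical_set_scope.
Local Open Scope ring_scope.
Local Open Scope complex_scope.

Section LebesgueTuple.
Context (R : realType).
(* R with its Borel sigma-algebra, the one of [lebesgue_measure] *)
Local Notation mR := (measurableTypeR R).
Local Open Scope ereal_scope.

Definition cons_pair n (p : mR * n.-tuple mR) : n.+1.-tuple mR :=
  [tuple of p.1 :: p.2].

Lemma measurable_cons_pair n :
  measurable_fun [set: mR * n.-tuple mR] (@cons_pair n).
Proof. exact: measurable_cons. Qed.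

Section step.
Context n (mu : {sigma_finite_measure set (n.-tuple mR) -> \bar R}).

Definition lebesgue_tupleS : set (n.+1.-tuple mR) -> \bar R :=
  pushforward (@lebesgue_measure R \x mu) (@cons_pair n).

Let lebesgue_tupleS0 : lebesgue_tupleS set0 = 0.
Proof. by rewrite /lebesgue_tupleS /pushforward preimage_set0 measure0. Qed.

Let lebesgue_tupleS_ge0 A : 0 <= lebesgue_tupleS A.
Proof. by rewrite /lebesgue_tupleS /pushforward measure_ge0. Qed.

Let lebesgue_tupleS_sigma_additive : semi_sigma_additive lebesgue_tupleS.
Proof.
move=> F mF tF mUF; rewrite /lebesgue_tupleS /pushforward preimage_bigcup.
apply: measure_semi_sigma_additive.
- by move=> i; rewrite -[X in measurable X]setTI; exact: measurable_cons_pair.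
- apply/trivIsetP => /= i j _ _ ij; rewrite -preimage_setI.
  by move/trivIsetP : tF => /(_ _ _ _ _ ij) ->//; rewrite preimage_set0.
- rewrite -preimage_bigcup -[X in measurable X]setTI.
  exact: measurable_cons_pair.
Qed.

HB.instance Definition _ := isMeasure.Build _ _ _ lebesgue_tupleS
  lebesgue_tupleS0 lebesgue_tupleS_ge0 lebesgue_tupleS_sigma_additive.

Let lebesgue_tupleS_sigma_finite : sigma_finite setT lebesgue_tupleS.
Proof.
have /sigma_finiteP[F [FT ndF Foo]] := sigma_finiteT (@lebesgue_measure R).
have /sigma_finiteP[G [GT ndG Goo]] := sigma_finiteT mu.
pose h (t : n.+1.-tuple mR) : mR * n.-tuple mR := (thead t, [tuple of behead t]).
have mh : measurable_fun setT h.
  apply/measurable_fun_pairP; split.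
  - exact: measurable_tnth.
  - exact: measurable_behead.
have hK p : h (cons_pair p) = p.
  by case: p => x t; rewrite /h theadE; congr pair; exact/val_inj.
exists (fun i => h @^-1` (F i `*` G i)).
  apply/esym; rewrite -subTset => t _.
  have [i _ Fi] : (\bigcup_i F i) (h t).1 by rewrite -FT.
  have [j _ Gj] : (\bigcup_i G i) (h t).2 by rewrite -GT.
  exists (maxn i j) => //; split.
  - by move: Fi; exact/subsetPset/ndF/leq_maxl.
  - by move: Gj; exact/subsetPset/ndG/leq_maxr.
move=> i; have [mF ltF] := Foo i; have [mG ltG] := Goo i; split.
  by rewrite -[X in measurable X]setTI; apply: mh => //; exact: measurableX.
rewrite /lebesgue_tupleS /pushforward -comp_preimage.
rewrite (_ : h \o _ = id) ?preimage_id; last by apply/funext => p; exact: hK.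
by rewrite product_measure1E// lte_mul_pinfty// ge0_fin_numE.
Qed.

HB.instance Definition _ := Measure_isSigmaFinite.Build _ _ _
  lebesgue_tupleS lebesgue_tupleS_sigma_finite.

End step.

(* Lebesgue measure on R^n, as the n-fold product of [lebesgue_measure] carried
   to n.-tuple R (with its Borel sigma-algebra) along R * R^n -> R^(n+1). *)
Fixpoint lebesgue_tuple n : {sigma_finite_measure set (n.-tuple mR) -> \bar R} :=
  match n with
  | 0 => \d_([tuple] : 0.-tuple mR)
  | n'.+1 => lebesgue_tupleS (lebesgue_tuple n')
  end.

End LebesgueTuple.

Section Algorithm.
Context (R : realType) (n k : nat).
Variables (a alpha : n.-tuple R) (b beta : k.-tuple R).

Local Notation C := R[i].
(* C[x,y], C[m,x,y] and C[g,m,x,y] as iterated univariate polynomials: the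
   variables g, m, x, y are taken in this order, from the outermost ring of
   polynomials to the innermost. *)
Local Notation Cxy := {poly {poly C}}.
Local Notation Cmxy := {poly Cxy}.
Local Notation Cgmxy := {poly Cmxy}.

Definition var_g : Cgmxy := 'X.
Definition var_m : Cgmxy := 'X%:P.
Definition var_x : Cgmxy := 'X%:P%:P.
Definition var_y : Cgmxy := 'X%:P%:P%:P.
Definition cst (c : C) : Cgmxy := c%:P%:P%:P%:P.

Definition polyP : Cgmxy :=
  let F i := var_g * (var_x - cst (tnth alpha i)%:C) + var_m in
  \prod_(i < n) F i
  - \sum_(i < n) cst (tnth a i)%:C * \prod_(s < n | s != i) F s.

Definition polyR : Cgmxy :=
  let F j := cst 'i * var_g * (var_y - cst (tnth beta j)%:C) + 1 - var_m in
  \prod_(j < k) F j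
  - \sum_(j < k) cst (tnth b j)%:C * \prod_(s < k | s != j) F s.

(* [resultant] is the determinant of the Sylvester matrix for the actual degrees
   in the outermost variable. Those of polyP and polyR in g are n and k whatever
   alpha and beta, the leading coefficients being prod_i (x - alpha_i) and
   prod_j i(y - beta_j). *)
Definition poly_f1 : Cmxy := resultant polyP polyR.

Definition divisor : Cmxy := 'X ^+ n.-1 * ('X - 1) ^+ k.-1.

(* The divisor is monic in m, so this is Euclidean division in C[x,y][m]. *)
Definition poly_f2 : Cmxy := poly_f1 %/ divisor.

Definition Re_f2 : {poly {poly {poly R}}} :=
  map_poly (map_poly (map_poly (@complex.Re R))) poly_f2.
Definition Im_f2 : {poly {poly {poly R}}} :=
  map_poly (map_poly (map_poly (@complex.Im R))) poly_f2.

Definition poly_f : {poly {poly R}} := resultant Re_f2 Im_f2.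

End Algorithm.

Section Omega.
Context (R : realType).

Definition cauchy_transform n (a alpha : n.-tuple R) (z : R[i]) : R[i] :=
  \sum_(i < n) (tnth a i)%:C / (z - (tnth alpha i)%:C).

(* The convention c / 0 = 0 adds no point to this set: at a pole alpha_i of G_p,
   the value given to G_p is real whereas g is not, and similarly for G_q, i g
   being non-real because g is not purely imaginary. *)
Definition Omega n k (a alpha : n.-tuple R) (b beta : k.-tuple R) : set R[i] :=
  [set z | exists (g : R[i]) (m : R),
    [/\ complex.Im g != 0, complex.Re g != 0,
        cauchy_transform a alpha ((complex.Re z)%:C + m%:C / g) = g &
        cauchy_transform b beta ((complex.Im z)%:C + (1 - m)%:C / ('i * g))
          = 'i * g]].

(* x is the outer variable of f and y the inner one. *)
Definition vanishes_on (f : {poly {poly R}}) (S : set R[i]) :=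
  forall z, S z -> f.[(complex.Re z)%:P].[complex.Im z] = 0.

End Omega.

(* Main.v *)
Require Import Defs.
From HB Require Import structures.
From mathcomp Require Import finmap.
From mathcomp Require Import all_boot all_order all_algebra.
From mathcomp Require Import perm zify ring lra.
From mathcomp Require Import complex.
From mathcomp Require Import all_classical all_reals all_analysis.
From mathcomp Require Import measurable_realfun.

Set Implicit Arguments.
Unset Strict Implicit.
Unset Printing Implicit Defensive.

Import Order.TTheory GRing.Theory Num.Theory.
Import numFieldNormedType.Exports.

Local Open Scope classical_set_scope.
Local Open Scope ring_scope.

(** Write P, R, f1, f2, f for the polynomials of the algorithm, N for n k and D
for (n - 1) (k - 1) + 1.

If z = x + i y is in Omega, with g and m as in its definition, then m is neither
0 nor 1 because G_p and G_q are real on the real line, and clearing denominators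
makes g a common root of P and R at (m, x, y). Hence f1, and then f2, vanishes
at (m, x, y). Since m, x and y are real, m is a common root of Re f2 and Im f2,
so that f (x, y) = 0 as soon as both have positive degree in m. What has to be
proved is therefore that f is not the zero polynomial, for almost all
parameters.

P and R are secular polynomials: the coefficient of g^l in P is a combination of
m^(n-l) and m^(n-1-l), and that in R of the same powers of 1 - m, with k in
place of n. Suitable weights on the rows and columns of the Sylvester matrix turn
this into the divisibility of f1 by m^(n-1) (m-1)^(k-1)
([sylvester_det_divides]) and into the bound N on its degree in m
([size_sylvester_det]). So f2 has degree at most D, and the Sylvester
determinant of Re f2 and Im f2 for the prescribed degrees D and D has
coefficients that are polynomial functions of (alpha, beta); it is f whenever
the coefficients of m^D in Re f2 and Im f2 are not zero.

The zeros of a polynomial function on R^n x R^k that is not identically zero form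
a null set ([pair_zeros_null]): this follows from Fubini, one variable at a
time, because a univariate polynomial has finitely many roots. It is thus enough
to find one parameter at which these two coefficients and the Sylvester
determinant are nonzero, and alpha = beta = 0 is one, whatever the weights
([origin_neq0]). There P = (g x + m)^(n-1) (g x + m - 1), and similarly for R,
so that the formula for the resultant in terms of the roots gives at x = 1, with
y = Y and w = 1 + i Y,

  f2 = +- w^N (m - 1/w)^((n-1)(k-1)) (m - i Y / w).

A common root of Re f2 and Im f2 is a root of f2 whose conjugate is also a root,
which is impossible unless Y = 0 or Y^2 = 1 ([coprime_real_imaginary_parts]).
Finally Y is chosen such that w^N is a real multiple of 1 + 2 i: then the
coefficient +- w^N of m^D has nonzero real and imaginary parts, and Y is not one
of the exceptions because for them w^4 is real, while (1 + 2 i)^4 is not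
([exists_generic_slope]). *)

(** * Sylvester determinants for prescribed degrees *)

Section Sylvester.
Context (A : comNzRingType).
Implicit Types (p q : {poly A}) (u : nat -> {poly A}).

(** A matrix is handled through the polynomials that its rows encode, indexed by
nat: shifting rows then needs no casts between ordinals. *)
Definition coef_mx N u : 'M[A]_N := \matrix_(i, j) (u i)`_j.

(** The size N and the number k of rows coming from p are prescribed, and not read
off the sizes of p and q: this is what makes the determinant commute with ring
morphisms and depend polynomially on the coefficients, also where leading
coefficients vanish. *)
Definition sylvester_row k p q i : {poly A} :=
  if (i < k)%N then 'X^i * p else 'X^(i - k) * q.

Definition sylvester_det N k p q : A := \det (coef_mx N (sylvester_row k p q)).

Lemma resultant_sylvester_det n k p q : size p = n.+1 -> size q = k.+1 ->
  resultant p q = sylvester_det (k + n) k p q.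
Proof.
move=> sp sq; rewrite /resultant; have ->: (k + n = (size q).-1 + (size p).-1)%N.
  by rewrite sp sq.
congr (\det _); apply/matrixP => i j; rewrite Sylvester_mxE mxE /sylvester_row.
have ek : (size q).-1 = k by rewrite sq.
case: splitP => l /= ->.
  rewrite (leq_trans (ltn_ord l)) ?ek // coefXnM ltnNge if_neg -mulrb //.
have -> : ((size q).-1 + l < k)%N = false by lia.
have -> : ((size q).-1 + l - k)%N = l by lia.
by rewrite coefXnM ltnNge if_neg -mulrb.
Qed.

End Sylvester.

Lemma map_sylvester_det (A B : comNzRingType) (f : {rmorphism A -> B}) N k
    (p q : {poly A}) :
  f (sylvester_det N k p q) = sylvester_det N k (map_poly f p) (map_poly f q).
Proof.
rewrite /sylvester_det -det_map_mx; congr (\det _); apply/matrixP => i j; rewrite !mxE.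
by rewrite /sylvester_row; case: ifP => _; rewrite !coefXnM; case: ifP => _;
  rewrite ?rmorph0 ?coef_map.
Qed.

(** Both products are determinants of diagonal matrices. *)
Lemma det_scale_rows_cols (A : comNzRingType) N (M L : 'M[A]_N)
    (r c : 'I_N -> A) :
    (forall i j, r i * M i j = c j * L i j) ->
  (\prod_i r i) * \det M = (\prod_j c j) * \det L.
Proof.
move=> rMcL.
have -> : \prod_i r i = \det (diag_mx (\row_i r i)).
  by rewrite det_diag; apply: eq_bigr => i _; rewrite mxE.
have -> : \prod_i c i = \det (diag_mx (\row_i c i)).
  by rewrite det_diag; apply: eq_bigr => i _; rewrite mxE.
rewrite [RHS]mulrC -!det_mulmx; congr (\det _); apply/matrixP => i j.
rewrite mul_diag_mx mul_mx_diag !mxE rMcL mulrC //.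
Qed.

(** In each term of the Leibniz formula the weights of the rows and of the columns
add up to the same totals, whatever the permutation. *)
Lemma size_det_weights (B : idomainType) N (M : 'M[{poly B}]_N)
    (r c : 'I_N -> nat) :
    (forall i j, M i j != 0 -> ((size (M i j)).-1 + c j <= r i)%N) ->
  (size (\det M) <= (\sum_i r i - \sum_j c j).+1)%N.
Proof.
move=> Mrc; apply: leq_trans (size_sum _ _ _) _; apply/bigmax_leqP => s _.
have [->|nz] := eqVneq (\prod_i M i (s i)) 0; first by rewrite mulr0 size_poly0.
have nzi i : M i (s i) != 0.
  by apply: contraNneq nz => z; rewrite (bigD1 i) //= z mul0r.
rewrite -(rmorph_sign polyC s) mul_polyC.
apply: leq_trans (size_scale_leq _ _) _.
apply: leq_trans (size_prod_leq _ _) _.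
have -> : (\sum_j c j = \sum_i c (s i))%N.
  by rewrite (reindex_inj (@perm_inj _ s)).
have -> : (\sum_i size (M i (s i)) = \sum_i (size (M i (s i))).-1 + #|'I_N|)%N.
  rewrite -sum1_card -big_split /=; apply: eq_bigr => i _.
  by rewrite addn1 prednK // size_poly_gt0.
have : (\sum_i (size (M i (s i))).-1 + \sum_i c (s i) <= \sum_i r i)%N.
  by rewrite -big_split; apply: leq_sum => i _ /=; apply: Mrc.
by rewrite -addSn addnK ltnS; lia.
Qed.

Definition divides (A : comNzRingType) (x y : A) := exists e, y = x * e.

Lemma divides0 (A : comNzRingType) (x : A) : divides x 0.
Proof. by exists 0; rewrite mulr0. Qed.

Lemma dividesM (A : comNzRingType) (x y x' y' : A) :
  divides x y -> divides x' y' -> divides (x * x') (y * y').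
Proof. by move=> [e ->] [e' ->]; exists (e * e'); rewrite mulrACA. Qed.

Lemma divides_trans (A : comNzRingType) (x y z : A) :
  divides x y -> divides y z -> divides x z.
Proof. by move=> [e ->] [e' ->]; exists (e * e'); rewrite mulrA. Qed.

Lemma divides_exp (A : comNzRingType) (x : A) m n :
  (m <= n)%N -> divides (x ^+ m) (x ^+ n).
Proof. by move=> mn; exists (x ^+ (n - m)); rewrite -exprD subnKC. Qed.

Lemma sum_ord_predB n d :
  (\sum_(j < n + d) (n.-1 - j) = \sum_(j < n) (n.-2 - j) + n.-1)%N.
Proof.
rewrite big_split_ord /= [X in (_ + X)%N]big1 ?addn0 => [|i _]; last by lia.
case: n => [|n]; first by rewrite !big_ord0.
rewrite big_ord_recl big_ord_recr /= subn0 addnC; congr (_ + _)%N.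
rewrite (_ : (n.-1 - n)%N = 0%N) ?addn0; last by lia.
by apply: eq_bigr => i _; rewrite /bump /=; lia.
Qed.

(** The weights r_i = v^(k-2-i) on the rows of p and c_j = u^(n-1-j) v^(k-1-j) on
the columns, with exponents truncated at 0, certify the order of vanishing of the
determinant: c_j divides r_i times the entry (i, j). On the diagonal j = i, where
the entry is p`_0, this uses the additional factor v. *)
Lemma sylvester_entry_divides (A : comNzRingType) n k (p : {poly A})
    (u v : A) i j :
    (i < k)%N ->
    (forall l, divides (u ^+ (n.-1 - l)) p`_l) ->
    divides (u ^+ n.-1 * v) p`_0 ->
  divides (u ^+ (n.-1 - j) * v ^+ (k.-1 - j)) (v ^+ (k.-2 - i) * ('X^i * p)`_j).
Proof.
move=> ik pl p0; rewrite coefXnM; case: ltngtP => [_|ij|<-].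
- by rewrite mulr0; exact: divides0.
- rewrite [X in divides X _]mulrC; apply: dividesM.
    by apply: divides_exp; lia.
  by apply: divides_trans (pl _); apply: divides_exp; lia.
- rewrite subnn; apply: divides_trans (dividesM (divides_exp v (leqnn _)) p0).
  rewrite mulrCA mulrA -mulrA -exprSr; apply: dividesM; apply: divides_exp; lia.
Qed.

(** Multiplying the rows by r_i makes the columns divisible by c_j, and the quotient
of the product of the c_j by that of the r_i is u^(n-1) v^(k-1). Treating u and v
together avoids an appeal to the coprimality of their powers. *)
Lemma sylvester_det_divides (A : idomainType) n k (p q : {poly A}) (u v : A) :
    u != 0 -> v != 0 ->
    (forall l, divides (u ^+ (n.-1 - l)) p`_l) ->
    divides (u ^+ n.-1 * v) p`_0 ->
    (forall l, divides (v ^+ (k.-1 - l)) q`_l) ->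
    divides (v ^+ k.-1 * u) q`_0 ->
  divides (u ^+ n.-1 * v ^+ k.-1) (sylvester_det (k + n) k p q).
Proof.
move=> u0 v0 pl p0 ql q0.
pose r (i : 'I_(k + n)) :=
  if (i < k)%N then v ^+ (k.-2 - i) else u ^+ (n.-2 - (i - k)).
pose c (j : 'I_(k + n)) := u ^+ (n.-1 - j) * v ^+ (k.-1 - j).
pose M := coef_mx (k + n) (sylvester_row k p q).
have rMc (i j : 'I_(k + n)) : divides (c j) (r i * M i j).
  rewrite /r /c !mxE /sylvester_row; case: ltnP => [ik|ki].
    exact: sylvester_entry_divides.
  rewrite [X in divides X _]mulrC; apply: sylvester_entry_divides => //.
  by have := ltn_ord i; lia.
have [L rMcL] : exists L : 'M[A]_(k + n), forall i j, r i * M i j = c j * L i j.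
  have /fin_all_exists[L HL] i : exists Li : 'I_(k + n) -> A,
      forall j, r i * M i j = c j * Li j.
    exact: fin_all_exists (rMc i).
  by exists (\matrix_(i, j) L i j) => i j; rewrite [in RHS]mxE HL.
exists (\det L).
have := det_scale_rows_cols rMcL.
have -> : \prod_i r i =
    v ^+ (\sum_(j < k) (k.-2 - j)) * u ^+ (\sum_(j < n) (n.-2 - j)).
  rewrite big_split_ord /=; congr (_ * _).
    by rewrite expr_sum; apply: eq_bigr => i _; rewrite /r /= ltn_ord.
  rewrite expr_sum; apply: eq_bigr => i _.
  by rewrite /r /= ltnNge leq_addr /= addKn.
have -> : \prod_j c j =
    u ^+ (\sum_(j < n) (n.-2 - j) + n.-1) * v ^+ (\sum_(j < k) (k.-2 - j) + k.-1).
  by rewrite big_split /= -!expr_sum sum_ord_predB [in X in u ^+ X]addnC sum_ord_predB.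
rewrite !exprD => H.
apply: (@mulfI _ (v ^+ (\sum_(j < k) (k.-2 - j)) * u ^+ (\sum_(j < n) (n.-2 - j)))).
  by rewrite mulf_neq0 // expf_neq0.
rewrite [LHS]H; ring.
Qed.

(** The degree of the resultant of two curves of degrees n and k, by the weights
n + i on the rows of p, i on the rows of q and j on the columns. *)
Lemma size_sylvester_det (B : idomainType) n k (p q : {poly {poly B}}) :
    (forall l, p`_l != 0 -> ((size (p`_l)%R).-1 + l <= n)%N) ->
    (forall l, q`_l != 0 -> ((size (q`_l)%R).-1 + l <= k)%N) ->
  (size (sylvester_det (k + n) k p q) <= (n * k).+1)%N.
Proof.
move=> pl ql; pose r (i : 'I_(k + n)) := if (i < k)%N then (n + i)%N else i : nat.
have Mrc (i j : 'I_(k + n)) : coef_mx (k + n) (sylvester_row k p q) i j != 0 ->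
    ((size (coef_mx (k + n) (sylvester_row k p q) i j)).-1 + j <= r i)%N.
  rewrite /r !mxE /sylvester_row.
  case: ltnP => ik; rewrite coefXnM; case: ltnP => ij; rewrite ?eqxx // => nz.
    by move: (pl _ nz); move: (size _) => z; lia.
  by move: (ql _ nz); move: (size _) => z; lia.
apply: leq_trans (size_det_weights Mrc) _; rewrite ltnS !big_split_ord /=.
rewrite (eq_bigr (fun i : 'I_k => (n + i)%N)) => [|i _]; last first.
  by rewrite /r /= ltn_ord.
rewrite [X in (_ + X - _)%N](eq_bigr (fun i : 'I_n => (k + i)%N)) => [|i _]; last first.
  by rewrite /r /= ltnNge leq_addr.
rewrite big_split /= sum_nat_const card_ord; lia.
Qed.

Section SylvRoots.
Context (A : comNzRingType).

Lemma sum_coef_shift N (f g : {poly A}) j : (size f <= N)%N ->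
  \sum_(l < N) f`_l * ('X^l * g)`_j = (f * g)`_j.
Proof.
move=> fN; have {2}-> : f = \poly_(l < N) f`_l.
  apply/polyP => l; rewrite coef_poly; case: ltnP => // Nl.
  by rewrite nth_default // (leq_trans fN).
rewrite poly_def mulr_suml coef_sum; apply: eq_bigr => l _.
by rewrite -scalerAl coefZ.
Qed.

(** The matrix of the family 1, X - r, X (X - r), X^2 (X - r), ... in the basis of
monomials, which is unitriangular. *)
Lemma det_monic_basis N (r : A) :
  \det (coef_mx N.+1 (fun i => if i is i'.+1 then 'X^i' * ('X - r%:P) else 1)) = 1.
Proof.
rewrite det_trig.
  rewrite big1 // => -[[|i] Hi] _; rewrite mxE /= ?coef1 // coefXnM ltnNge leqnSn /=.
  by rewrite subSnn coefB coefX coefC subr0.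
apply/is_trig_mxP => -[[|i] Hi] [j Hj] /= ij; rewrite mxE /=.
  by rewrite coef1; case: j ij {Hj}.
rewrite coefXnM ltnNge (ltnW (ltnW ij)) /= coefB coefX coefC.
have [-> ->] : (j - i == 1 = false)%N /\ (j - i == 0 = false)%N by lia.
  by rewrite subr0.
Qed.

(** In the basis 1, X - r, X (X - r), ... the rows X^i (X - r) p lose their factor
X - r and have no component on 1. After subtracting from each row X^i q with
i > 0 the multiple r X^(i-1) q, it becomes (X - r) X^(i-1) q, with the same
effect. The only row left with a component on 1 is q = q(r) + c (X - r), and the
expansion along the corresponding column gives the formula. *)
Lemma sylvester_det_XsubC n k (p q : {poly A}) r :
  (size p <= n.+1)%N -> (size q <= k.+1)%N ->
  sylvester_det (k + n).+1 k (('X - r%:P) * p) q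
  = (-1) ^+ k * q.[r] * sylvester_det (k + n) k p q.
Proof.
move=> sp sq; set N := (k + n)%N.
set S := coef_mx N.+1 (sylvester_row k (('X - r%:P) * p) q).
have [c [Dq sc]] : exists c, q = q.[r]%:P + c * ('X - r%:P) /\ (size c <= k)%N.
  have /factor_theorem [c Dc] : root (q - q.[r]%:P) r.
    by rewrite /root !hornerE subrr.
  exists c; rewrite -Dc addrC subrK; split => //.
  have [->|c0] := eqVneq c 0; first by rewrite size_poly0.
  rewrite -ltnS; have <- : size (q - q.[r]%:P) = (size c).+1.
    by rewrite Dc size_Mmonic ?monicXsubC // size_XsubC addn2.
  rewrite (leq_trans (size_polyD _ _)) // geq_max sq size_polyN size_polyC.
  by case: (_ != 0).
(* V does the row operations and W is the change of basis: V S = B W. *)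
pose W := coef_mx N.+1 (fun i => if i is i'.+1 then 'X^i' * ('X - r%:P) else 1).
pose V : 'M[A]_N.+1 := \matrix_(i, j)
  ((i == j)%:R - ((k < i)%N && (j.+1 == i))%:R * r).
pose b i := if (i < k)%N then 'X^i * p else if i == k then c else 'X^(i - k.+1) * q.
pose B : 'M[A]_N.+1 := \matrix_(i, j)
  (if val j is j'.+1 then (b i)`_j' else (val i == k)%:R * q.[r]).
have size_b i : (i <= k + n)%N -> (size (b i) <= k + n)%N.
  rewrite /b => iN; have [ik|ki|_] := ltngtP i k.
  - apply: leq_trans (size_polyMleq _ _) _; rewrite size_polyXn.
    by move: sp; move: (size p) => x; clear -ik; lia.
  - apply: leq_trans (size_polyMleq _ _) _; rewrite size_polyXn.
    by move: sq; move: (size q) => x; clear -ki iN; lia.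
  - by rewrite (leq_trans sc) // leq_addr.
have detV : \det V = 1.
  rewrite det_trig.
    by rewrite big1 // => i _; rewrite mxE eqxx gtn_eqF // andbF mul0r subr0.
  apply/is_trig_mxP => i j ij; rewrite mxE -val_eqE /= (ltn_eqF ij).
  by rewrite (_ : j.+1 == i = false) ?andbF ?mul0r ?subrr //; apply/eqP; lia.
have detB : \det B = (-1) ^+ k * q.[r] * sylvester_det (k + n) k p q.
  have kN : (k < N.+1)%N by rewrite ltnS leq_addr.
  rewrite (expand_det_col B ord0) (bigD1 (Ordinal kN)) //= big1 ?addr0; last first.
    by move=> i; rewrite mxE -val_eqE /= => /negPf ->; rewrite !mul0r.
  rewrite mxE /= eqxx mul1r /cofactor /= addn0 mulrCA mulrA; congr (_ * \det _).
  apply/matrixP => i j; rewrite !mxE /= /b /sylvester_row /bump.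
  case: (ltnP i k) => ik; first by rewrite /= add0n ik.
  by rewrite /= add1n ltnNge (leq_trans ik) //= gtn_eqF // subSS.
have VS : V *m S = B *m W.
  apply/matrixP => i j; rewrite mxE [RHS]mxE.
  transitivity (((i == k :> nat)%:R * q.[r])%:P + b i * ('X - r%:P))`_j; last first.
    rewrite big_ord_recl !mxE /= coefD; congr (_ + _).
      by rewrite coef1 coefC; case: (val j == 0%N); rewrite ?mulr1 ?mulr0.
    rewrite -(@sum_coef_shift N) ?size_b -1?ltnS //.
    by apply: eq_bigr => l _; rewrite !mxE.
  transitivity ((sylvester_row k (('X - r%:P) * p) q i)`_j
      - (k < i)%N%:R * r * (sylvester_row k (('X - r%:P) * p) q i.-1)`_j).
    under eq_bigr do rewrite !mxE mulrBl.
    rewrite sumrB (bigD1 i) //= eqxx mul1r big1 ?addr0 => [|l li]; last first.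
      by rewrite eq_sym (negPf li) mul0r.
    congr (_ - _); have [ki|ik] := ltnP k i; last first.
      by rewrite big1 ?mul0r // => l _; rewrite !mul0r.
    have iN : (i.-1 < N.+1)%N by have := ltn_ord i; lia.
    rewrite (bigD1 (Ordinal iN)) //= big1 ?addr0 => [|l]; last first.
      rewrite -val_eqE /= => li; rewrite (_ : l.+1 == i = false) ?mul0r //.
      by apply/eqP; lia.
    by rewrite (_ : i.-1.+1 == i = true) //; apply/eqP; lia.
  rewrite -coefZ -coefB; apply: (congr1 (fun f : {poly A} => f`_j)).
  rewrite /sylvester_row /b.
  case: (ltngtP i k) => [ik|ki|->].
  - by rewrite mul0r scale0r subr0 mul0r polyC0 add0r mulrCA mulrC.
  - rewrite (_ : (i.-1 < k)%N = false); last lia.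
    rewrite mul1r mul0r polyC0 add0r (_ : (i - k = (i - k.+1).+1)%N); last lia.
    rewrite (_ : (i.-1 - k = i - k.+1)%N); last lia.
    by rewrite -mul_polyC exprS; ring.
  - by rewrite subnn mul0r scale0r subr0 !mul1r {1}Dq.
have := congr1 determinant VS; rewrite !det_mulmx detV det_monic_basis mul1r mulr1.
by rewrite detB.
Qed.

(** The formula of the resultant in terms of the roots of one polynomial, by
splitting off one root at a time; it needs no division, and so holds over any
commutative ring. *)
Lemma sylvester_det_roots k (rs : seq A) c (q : {poly A}) :
  (size q <= k.+1)%N ->
  sylvester_det (k + size rs) k (c *: \prod_(r <- rs) ('X - r%:P)) q
  = (-1) ^+ (k * size rs) * c ^+ k * \prod_(r <- rs) q.[r].
Proof.
move=> sq; elim: rs => [|r rs IH].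
  rewrite !big_nil muln0 mul1r mulr1 addn0 /sylvester_det det_trig.
    rewrite -[in RHS](card_ord k) -prodr_const; apply: eq_bigr => i _.
    by rewrite mxE /sylvester_row ltn_ord coefXnM ltnn subnn coefZ coef1 mulr1.
  apply/is_trig_mxP => i j ij.
  rewrite mxE /sylvester_row ltn_ord coefXnM ltnNge (ltnW ij) /=.
  by rewrite coefZ coef1 subn_eq0 leqNgt ij mulr0.
rewrite /= addnS !big_cons scalerAr sylvester_det_XsubC // ?IH; last first.
  by rewrite (leq_trans (size_scale_leq _ _)) // size_prod_XsubC.
rewrite mulnS exprD; move: ((-1) ^+ k) ((-1) ^+ (k * _)) => x y; ring.
Qed.
End SylvRoots.

(** The resultant is in the ideal generated by p and q. Nonconstancy is essential:
the resultant of two constants is 1, even if both are zero. *)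
Lemma resultant_common_root (A B : comNzRingType) (f : {rmorphism A -> B})
    (p q : {poly A}) g :
    (1 < size p)%N -> (1 < size q)%N ->
    (map_poly f p).[g] = 0 -> (map_poly f q).[g] = 0 ->
  f (resultant p q) = 0.
Proof.
move=> sp sq pg qg; have [[u v] _ /= E] := resultant_in_ideal sp sq.
have := congr1 (fun r => (map_poly f r).[g]) E.
by rewrite map_polyC hornerC rmorphD !rmorphM /= hornerD !hornerM_comm
  ?pg ?qg ?mulr0 ?addr0 //; exact: mulrC.
Qed.

Lemma size_coef_neq0 (A : nzRingType) (p : {poly A}) d :
  (size p <= d.+1)%N -> p`_d != 0 -> size p = d.+1.
Proof.
move=> sp pd; apply/eqP; rewrite eqn_leq sp /= ltnNge; apply/negP => /leq_sizeP.
by move=> /(_ d (leqnn d)); apply/eqP.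
Qed.

(** * Secular polynomials *)

Section Secular.

(** The polynomial is obtained by clearing denominators in the secular equation
sum_i a_i / (c_i g + w) = 1; the variable g is the outer one, and w is a
polynomial in one variable, which will be m or 1 - m. Both P and R have this
form. *)
Definition secular (B : comNzRingType) n (a c : 'I_n -> B) (w : {poly B}) :
    {poly {poly B}} :=
  let F i := (c i)%:P%:P * 'X + w%:P in
  \prod_(i < n) F i - \sum_(i < n) (a i)%:P%:P * \prod_(s < n | s != i) F s.

(** The product is homogeneous in X and w, and its coefficients e l are constants
with respect to the variable of w. *)
Lemma coef_prod_affine (B : comNzRingType) I (r : seq I) (P : pred I)
    (c : I -> B) (w : {poly B}) :
  exists e : nat -> B,
    [/\ e 0%N = 1, e (count P r) = \prod_(i <- r | P i) c i,
        forall l, (count P r < l)%N -> e l = 0 &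
        forall l, (\prod_(i <- r | P i) ((c i)%:P%:P * 'X + w%:P))`_l
                  = (e l)%:P * w ^+ (count P r - l)].
Proof.
elim: r => [|i r [e [e0 ec eN el]]].
  exists (fun l => (l == 0)%:R); split=> // [|[]//|l]; rewrite big_nil //.
  by rewrite coef1 mulr1 polyC_natr.
rewrite /=; case Pi: (P i); last first.
  by exists e; split=> // [|l]; rewrite big_cons Pi.
exists (fun l => if l is l'.+1 then c i * e l' + e l else 1); split => //.
- by rewrite add1n big_cons Pi -ec (eN _ (ltnSn _)) addr0.
- by case=> // l; rewrite add1n ltnS => cl; rewrite !eN ?mulr0 ?addr0 // ltnS ltnW.
- move=> l; rewrite big_cons Pi add1n mulrDl -mulrA coefD !coefCM coefXM.
  case: l => [|l] /=; first by rewrite mulr0 add0r el e0 !mul1r !subn0 exprS.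
  rewrite !el subSS polyCD polyCM [RHS]mulrDl mulrA; congr (_ + _).
  have [lc|cl] := ltnP l (count P r); last by rewrite eN ?ltnS // !mul0r mulr0.
  by rewrite mulrCA -exprS; congr (_ * _ ^+ _); lia.
Qed.

Context (B : idomainType) (n : nat) (a c : 'I_n -> B) (w : {poly B}).
Hypotheses (n_gt0 : (0 < n)%N) (suma : \sum_(i < n) a i = 1).

(** The first part comes from the product of all factors and is homogeneous of
degree n in g and w, the second one from the products of n - 1 factors. *)
Lemma coef_secular : exists e e' : nat -> B,
  [/\ e 0%N = 1 /\ e' 0%N = 1, e n = \prod_i c i,
      forall l, (n < l)%N -> e l = 0, forall l, (n <= l)%N -> e' l = 0 &
      forall l, (secular a c w)`_l
        = (e l)%:P * w ^+ (n - l) - (e' l)%:P * w ^+ (n.-1 - l)].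
Proof.
have [e [e0 en eN el]] := coef_prod_affine (index_enum 'I_n) xpredT c w.
have cn : count xpredT (index_enum 'I_n) = n.
  by rewrite -sum1_count sum1_card card_ord.
have cn1 i : count [pred s | s != i] (index_enum 'I_n) = n.-1.
  by rewrite -sum1_count sum1_card cardC1 card_ord.
have /fin_all_exists [e' e'P] i :=
  coef_prod_affine (index_enum 'I_n) [pred s | s != i] c w.
exists e, (fun l => \sum_i a i * e' i l); rewrite cn in en eN el; split => //.
- split=> //; rewrite -[RHS]suma; apply: eq_bigr => i _.
  by have [-> _ _ _] := e'P i; rewrite mulr1.
- move=> l nl; rewrite big1 // => i _; have [_ _ e'N _] := e'P i.
  by rewrite e'N ?mulr0 // cn1 prednK.
- move=> l; rewrite coefB el coef_sum; congr (_ - _).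
  rewrite rmorph_sum mulr_suml; apply: eq_bigr => i _.
  by have [_ _ _] := e'P i; rewrite cn1 coefCM => ->; rewrite mulrA -polyCM.
Qed.

Lemma secular_divides l : divides (w ^+ (n.-1 - l)) (secular a c w)`_l.
Proof.
have [e [e' [_ _ _ _ ->]]] := coef_secular.
have -> : w ^+ (n - l) = w ^+ (n.-1 - l) * w ^+ ((n - l) - (n.-1 - l)).
  by rewrite -exprD subnKC //; lia.
by exists ((e l)%:P * w ^+ ((n - l) - (n.-1 - l)) - (e' l)%:P); ring.
Qed.

(** The constant term is w^n - w^(n-1), since the weights a add up to 1. *)
Lemma secular_divides0 : divides (w ^+ n.-1 * (1 - w)) (secular a c w)`_0.
Proof.
have [e [e' [[e0 e'0] _ _ _ ->]]] := coef_secular; exists (-1).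
rewrite e0 e'0 !subn0 -[in LHS](prednK n_gt0) /= exprS; ring.
Qed.

Lemma size_coef_secular l : (size w <= 2)%N -> (secular a c w)`_l != 0 ->
  ((size ((secular a c w)`_l)%R).-1 + l <= n)%N.
Proof.
move=> sw; have [e [e' [_ _ eN e'N ->]]] := coef_secular.
have spow (x : B) j : (size (x%:P * w ^+ j)%R <= j.+1)%N.
  rewrite mul_polyC (leq_trans (size_scale_leq _ _)) //.
  rewrite (leq_trans (size_poly_exp_leq _ _)) // ltnS.
  by rewrite -[X in (_ <= X)%N]mul1n leq_mul2r; case: (size w) sw => [|[|[]]] //=;
    rewrite orbT.
have [nl|ln] := ltnP n l.
  by rewrite eN // e'N ?(ltnW nl) // !mul0r subrr eqxx.
move=> _; suff: (size ((e l)%:P * w ^+ (n - l) - (e' l)%:P * w ^+ (n.-1 - l))%R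
    <= (n - l).+1)%N by move: (size _) => z; lia.
rewrite (leq_trans (size_polyD _ _)) // geq_max spow size_polyN.
by rewrite (leq_trans (spow _ _)) // ltnS leq_sub2r // leq_pred.
Qed.

Lemma size_secular : \prod_i c i != 0 -> size (secular a c w) = n.+1.
Proof.
have [e [e' [_ en eN e'N el]]] := coef_secular => c0.
apply: size_coef_neq0; last by rewrite el e'N // en subnn mulr1 mul0r subr0 polyC_eq0.
by apply/leq_sizeP => l nl; rewrite el eN // e'N ?(ltnW nl) // !mul0r subrr.
Qed.

Lemma secular_root (K : fieldType) (psi : {rmorphism {poly B} -> K}) g :
    (forall i, psi (c i)%:P * g + psi w != 0) ->
    \sum_i psi (a i)%:P / (psi (c i)%:P * g + psi w) = 1 ->
  (map_poly psi (secular a c w)).[g] = 0.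
Proof.
move=> nz s1; pose G i := psi (c i)%:P * g + psi w.
have evF i : (map_poly psi ((c i)%:P%:P * 'X + w%:P)).[g] = G i.
  by rewrite rmorphD rmorphM /= !map_polyC map_polyX !hornerE.
rewrite /secular rmorphB rmorph_prod rmorph_sum /= hornerD hornerN horner_prod horner_sum.
under eq_bigr do rewrite evF.
under [X in _ - X]eq_bigr => i _.
  rewrite rmorphM rmorph_prod /= hornerM horner_prod map_polyC hornerC.
  under eq_bigr do rewrite evF.
  rewrite (_ : _ * _ = psi (a i)%:P / G i * \prod_i G i); first over.
  by rewrite [in RHS](bigD1 i) //= mulrA divfK ?nz.
by rewrite -mulr_suml s1 mul1r subrr.
Qed.

End Secular.

(** When the c_i coincide, the weights disappear. *)
Lemma secular_const (B : comNzRingType) n (a : 'I_n -> B) (c : B) (w : {poly B}) :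
    (0 < n)%N -> \sum_(i < n) a i = 1 ->
  secular a (fun=> c) w
  = (c%:P%:P * 'X + w%:P) ^+ n.-1 * (c%:P%:P * 'X + w%:P - 1).
Proof.
move=> n0 suma; rewrite /secular prodr_const card_ord.
under eq_bigr do rewrite prodr_const cardC1 card_ord.
rewrite -mulr_suml -!rmorph_sum /= suma !polyC1 mul1r mulrBr mulr1.
by rewrite -exprSr prednK.
Qed.

Lemma map_secular (B B' : comNzRingType) (f : {rmorphism B -> B'}) n
    (a c : 'I_n -> B) (w : {poly B}) :
  map_poly (map_poly f) (secular a c w)
  = secular (f \o a) (f \o c) (map_poly f w).
Proof.
rewrite /secular rmorphB rmorph_prod rmorph_sum /=.
have E i : map_poly (map_poly f) ((c i)%:P%:P * 'X + w%:P) =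
    (f (c i))%:P%:P * 'X + (map_poly f w)%:P.
  by rewrite rmorphD rmorphM /= !map_polyC /= map_polyC map_polyX.
congr (_ - _); first by apply: eq_bigr => i _; exact: E.
apply: eq_bigr => i _; rewrite rmorphM rmorph_prod /= !map_polyC /= map_polyC.
by congr (_ * _); apply: eq_bigr => s _; exact: E.
Qed.

(** * Zeros of polynomial functions *)

Section PolyFun.
Context (R : realType).

(** The functions of the ring generated by the constants and by the coordinates
x i. An inductive predicate is enough, as the proof about null sets only freezes
all coordinates but one. *)
Inductive polyfun (T I : Type) (x : I -> T -> R) : (T -> R) -> Prop :=
| polyfun_cst c : polyfun x (fun=> c)
| polyfun_coord i : polyfun x (x i)
| polyfunD f g : polyfun x f -> polyfun x g -> polyfun x (fun t => f t + g t)
| polyfunM f g : polyfun x f -> polyfun x g -> polyfun x (fun t => f t * g t).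

(** For phi the insertion of frozen coordinates, this is the stability under
slicing. *)
Lemma polyfun_comp S T I J (x : I -> T -> R) (y : J -> S -> R) (phi : S -> T) f :
  (forall i, polyfun y (x i \o phi)) -> polyfun x f -> polyfun y (f \o phi).
Proof.
move=> xphi; elim=> [c|i|g h _ IHg _ IHh|g h _ IHg _ IHh].
- exact: polyfun_cst.
- exact: xphi.
- exact: polyfunD IHg IHh.
- exact: polyfunM IHg IHh.
Qed.

Lemma polyfun_line (f : R -> R) :
  polyfun (fun _ : unit => id) f -> exists p : {poly R}, f = horner p.
Proof.
elim=> [c|_|g h _ [p ->] _ [q ->]|g h _ [p ->] _ [q ->]].
- by exists c%:P; apply/funext => t; rewrite hornerC.
- by exists 'X; apply/funext => t; rewrite hornerX.
- by exists (p + q); apply/funext => t; rewrite hornerD.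
- by exists (p * q); apply/funext => t; rewrite hornerM.
Qed.

Lemma polyfun_measurable d (T : measurableType d) I
    (x : I -> T -> measurableTypeR R) f :
  (forall i, measurable_fun setT (x i)) -> polyfun x f ->
  measurable_fun setT (f : T -> measurableTypeR R).
Proof.
move=> mx; elim=> [c|i|g h _ mg _ mh|g h _ mg _ mh].
- exact: measurable_cst.
- exact: mx.
- exact: measurable_funD.
- exact: measurable_funM.
Qed.

Lemma measurable_zeros d (T : measurableType d) (f : T -> measurableTypeR R) :
  measurable_fun setT f -> measurable [set t | f t = 0].
Proof.
move=> mf; rewrite (_ : [set _ | _] = setT `&` f @^-1` [set 0]) ?setTI //.
by rewrite -[X in measurable X]setTI; exact: mf.
Qed.

(** For x outside the first null set, the slice of the zeros over x is null, so
that the integral computing the product measure is that of a function vanishing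
almost everywhere. *)
Lemma null_zeros_slices d1 d2 (T1 : measurableType d1) (T2 : measurableType d2)
    (m1 : {sigma_finite_measure set T1 -> \bar R})
    (m2 : {sigma_finite_measure set T2 -> \bar R})
    (f : T1 * T2 -> measurableTypeR R) (y0 : T2) :
    measurable_fun setT f ->
    m1 [set x | f (x, y0) = 0] = 0%E ->
    (forall x, f (x, y0) != 0 -> m2 [set y | f (x, y) = 0] = 0%E) ->
  (m1 \x m2)%E [set z | f z = 0] = 0%E.
Proof.
move=> mf z1 z2; set Z := [set z | f z = 0].
have mZ : measurable Z by exact: measurable_zeros.
rewrite /product_measure1 (ae_eq_integral (cst 0%E)) ?integral0 //.
- exact: measurable_fun_xsection.
- exists [set x | f (x, y0) = 0]; split => //.
    rewrite (_ : [set _ | _] = ysection Z y0); last first.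
      by apply/seteqP; split => x /=; rewrite /ysection /= inE.
    exact: measurable_ysection.
  move=> x /= fx; apply: contrapT => /eqP fx0; apply: fx => _.
  rewrite -[RHS](z2 x fx0); congr (m2 _).
  by apply/seteqP; split => y /=; rewrite /xsection /= inE.
Qed.

Definition tuple_coord n (i : 'I_n) (t : n.-tuple R) : R := tnth t i.

Definition pair_coord n k (i : 'I_n + 'I_k) (z : n.-tuple R * k.-tuple R) : R :=
  match i with inl i => tnth z.1 i | inr j => tnth z.2 j end.

Lemma line_zeros_null (f : R -> R) x0 :
  polyfun (fun _ : unit => id) f -> f x0 != 0 ->
  @lebesgue_measure R [set x | f x = 0] = 0%E.
Proof.
move=> /polyfun_line[p ->] px0; apply: countable_lebesgue_measure0.
apply: finite_set_countable; apply: contrapT => /(infinite_set_fset (size p)).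
move=> [B Bp]; apply/negP; rewrite -ltnNge; apply: max_poly_roots.
- by apply: contraNneq px0 => ->; rewrite horner0.
- by apply/allP => x /Bp /= px; apply/rootP.
- exact: fset_uniq.
Qed.

(** One coordinate is split off at a time. The slices that enter
[null_zeros_slices] are zero sets of polynomial functions that do not vanish
identically: the first one because f t0 is not zero, the others by
hypothesis. *)
Lemma tuple_zeros_null n (f : n.-tuple R -> R) t0 :
  polyfun (@tuple_coord n) f -> f t0 != 0 ->
  lebesgue_tuple R n [set t | f t = 0] = 0%E.
Proof.
elim: n f t0 => [|n IHn] f t0 pf f0 /=.
  rewrite (tuple0 t0) in f0.
  by rewrite /dirac/= indicE memNset //=; apply/eqP.
have mf : measurable_fun setT (f \o @cons_pair R n : _ -> measurableTypeR R).
  have mf1 : measurable_fun [set: n.+1.-tuple (measurableTypeR R)]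
      (f : _ -> measurableTypeR R).
    by apply: polyfun_measurable pf => i; exact: measurable_tnth.
  exact: (measurableT_comp mf1 (@measurable_cons_pair R n)).
rewrite /lebesgue_tupleS /pushforward.
apply: (null_zeros_slices (f := f \o @cons_pair R n) (y0 := [tuple of behead t0])) => //.
- apply: (@line_zeros_null _ (thead t0)).
    apply: (polyfun_comp (phi := fun x => cons_pair (x, [tuple of behead t0]))) pf => i.
    case: (unliftP ord0 i) => [j ->|->].
      rewrite (_ : _ \o _ = fun=> tnth [tuple of behead t0] j); first exact: polyfun_cst.
      by apply/funext => x; rewrite /= /tuple_coord tnthS.
    rewrite (_ : _ \o _ = id); first exact: (polyfun_coord (fun=> id) tt).
    by apply/funext => x; rewrite /= /tuple_coord tnth0.
  by rewrite /= /cons_pair /= -tuple_eta.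
- move=> x fx; apply: IHn fx.
  apply: (polyfun_comp (phi := fun t => cons_pair (x, t))) pf => i.
  case: (unliftP ord0 i) => [j ->|->].
    rewrite (_ : _ \o _ = tuple_coord j); first exact: polyfun_coord.
    by apply/funext => t; rewrite /= /tuple_coord tnthS.
  rewrite (_ : _ \o _ = fun=> x); first exact: polyfun_cst.
  by apply/funext => t; rewrite /= /tuple_coord tnth0.
Qed.

Lemma pair_zeros_null n k (f : n.-tuple R * k.-tuple R -> R) z0 :
  polyfun (@pair_coord n k) f -> f z0 != 0 ->
  (lebesgue_tuple R n \x lebesgue_tuple R k)%E.-negligible [set z | f z = 0].
Proof.
move=> pf f0.
have mf : measurable_fun
    [set: n.-tuple (measurableTypeR R) * k.-tuple (measurableTypeR R)]
    (f : _ -> measurableTypeR R).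
  apply: polyfun_measurable pf => -[i|j].
    apply: (measurableT_comp (measurable_tnth i)); exact: measurable_fst.
  apply: (measurableT_comp (measurable_tnth j)); exact: measurable_snd.
apply/negligibleP; first exact: measurable_zeros.
apply: (@null_zeros_slices _ _ _ _
  (lebesgue_tuple R n) (lebesgue_tuple R k) f z0.2) => //.
- apply: (@tuple_zeros_null _ (fun t => f (t, z0.2)) z0.1); last by case: (z0) f0.
  apply: (polyfun_comp (phi := fun t => (t, z0.2))) pf => -[i|j].
    exact: (polyfun_coord _ i).
  exact: (polyfun_cst _ (tnth z0.2 j)).
- move=> x fx; apply: (@tuple_zeros_null _ (fun t => f (x, t)) z0.2) => //.
  apply: (polyfun_comp (phi := fun t => (x, t))) pf => -[i|j].
    exact: (polyfun_cst _ (tnth x i)).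
  exact: (polyfun_coord _ j).
Qed.

End PolyFun.

Local Open Scope complex_scope.

(** * Families depending polynomially on a parameter *)

Section Families.
Context (T : Type).

(** A class Q of functions from T to V that is closed under the ring operations and
contains the constants. With Q the polynomial functions of a real parameter, it
is lifted below to parametrized complex numbers and polynomials, so that every
step of the algorithm can be followed coefficientwise. *)
Definition subring_family (V : nzRingType) (Q : (T -> V) -> Prop) :=
  [/\ forall c, Q (fun=> c),
      forall u v, Q u -> Q v -> Q (fun t => u t + v t) &
      forall u v, Q u -> Q v -> Q (fun t => u t * v t)].

Definition coef_family (V : nzRingType) (Q : (T -> V) -> Prop)
  (u : T -> {poly V}) := forall l, Q (fun t => (u t)`_l).

Section Closure.
Context (V : nzRingType) (Q : (T -> V) -> Prop) (Qr : subring_family Q).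

Lemma family_sum I (r : seq I) (P : pred I) (F : I -> T -> V) :
  (forall i, Q (F i)) -> Q (fun t => \sum_(i <- r | P i) F i t).
Proof.
case: Qr => Qc QD _ QF; elim: r => [|i r IH].
  by under eq_fun do rewrite big_nil; exact: Qc.
under eq_fun do rewrite big_cons; case: (P i) => //.
exact: QD.
Qed.

Lemma family_prod I (r : seq I) (P : pred I) (F : I -> T -> V) :
  (forall i, Q (F i)) -> Q (fun t => \prod_(i <- r | P i) F i t).
Proof.
case: Qr => Qc _ QM QF; elim: r => [|i r IH].
  by under eq_fun do rewrite big_nil; exact: Qc.
under eq_fun do rewrite big_cons; case: (P i) => //.
exact: QM.
Qed.

Lemma familyN u : Q u -> Q (fun t => - u t).
Proof.
case: Qr => Qc _ QM Qu; under eq_fun do rewrite -mulN1r.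
exact: QM.
Qed.

Lemma coef_subring_family : subring_family (coef_family Q).
Proof.
case: (Qr) => Qc QD QM; split.
- by move=> c l; exact: Qc.
- by move=> u v Qu Qv l; under eq_fun do rewrite coefD; exact: QD.
- move=> u v Qu Qv l; under eq_fun do rewrite coefM.
  by apply: family_sum => i; exact: QM.
Qed.

End Closure.

Lemma family_det (V : comNzRingType) (Q : (T -> V) -> Prop) N
    (M : T -> 'M[V]_N) :
  subring_family Q -> (forall i j, Q (fun t => M t i j)) ->
  Q (fun t => \det (M t)).
Proof.
move=> Qr Mij; apply: (family_sum Qr) => s.
by have [Qc _ QM] := Qr; apply: QM; [exact: Qc | apply: (family_prod Qr)].
Qed.

Lemma family_sylvester_det (V : comNzRingType) (Q : (T -> V) -> Prop) N k p q :
  subring_family Q -> coef_family Q p -> coef_family Q q ->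
  Q (fun t => sylvester_det N k (p t) (q t)).
Proof.
move=> Qr Qp Qq; apply: family_det => // i j; under eq_fun do rewrite mxE /sylvester_row.
have [Qc _ _] := Qr.
by case: (ltnP i k) => _; under eq_fun do rewrite coefXnM; case: (ltnP j _) => _.
Qed.

(** Euclidean division by a fixed monic polynomial is linear in the dividend. The
uniform bound on the sizes is what writes the quotient as a sum over a fixed set
of indices. *)
Lemma family_divp (V : idomainType) (Q : (T -> V) -> Prop)
    (p : T -> {poly V}) d N :
    subring_family Q -> coef_family Q p -> d \is monic ->
    (forall t, (size (p t) <= N)%N) ->
  coef_family Q (fun t => p t %/ d).
Proof.
move=> Qr Qp dm sp l; have [Qc _ QM] := Qr.
have ud : lead_coef d \is a GRing.unit by rewrite (monicP dm) unitr1.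
have -> : (fun t => (p t %/ d)`_l) =
    (fun t => \sum_(j < N) (p t)`_j * ('X^j %/ d)`_l).
  apply/funext => t; have {1}-> : p t = \sum_(j < N) (p t)`_j *: 'X^j.
    rewrite -poly_def; apply/polyP => j; rewrite coef_poly; case: ltnP => // Nj.
    by rewrite nth_default // (leq_trans (sp t)).
  elim/big_rec2: _ => [|j y1 y2 _ <-]; first by rewrite div0p coef0.
  by rewrite (Pdiv.IdomainUnit.divpD ud) (Pdiv.IdomainUnit.divpZl ud) coefD coefZ.
by apply: family_sum => // j; apply: QM; [exact: Qp | exact: Qc].
Qed.

Section ComplexFamily.
Context (R : rcfType) (Q : (T -> R) -> Prop).

Definition complex_family (u : T -> R[i]) :=
  Q (fun t => complex.Re (u t)) /\ Q (fun t => complex.Im (u t)).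

Lemma complex_subring_family : subring_family Q -> subring_family complex_family.
Proof.
move=> Qr; have [Qc QD QM] := Qr; split.
- by move=> c; split; exact: Qc.
- move=> u v [Qu Qu'] [Qv Qv']; split.
    rewrite (_ : (fun _ => _) = (fun t => complex.Re (u t) + complex.Re (v t))).
      exact: QD.
    by apply/funext => t; case: (u t) (v t) => ? ? [].
  rewrite (_ : (fun _ => _) = (fun t => complex.Im (u t) + complex.Im (v t))).
    exact: QD.
  by apply/funext => t; case: (u t) (v t) => ? ? [].
- move=> u v [Qu Qu'] [Qv Qv']; split.
    rewrite (_ : (fun _ => _) = (fun t => complex.Re (u t) * complex.Re (v t)
                               + - (complex.Im (u t) * complex.Im (v t)))).
      by apply: QD; [|apply: familyN => //]; exact: QM.
    by apply/funext => t; case: (u t) (v t) => ? ? [].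
  rewrite (_ : (fun _ => _) = (fun t => complex.Re (u t) * complex.Im (v t)
                             + complex.Im (u t) * complex.Re (v t))).
    by apply: QD; exact: QM.
  by apply/funext => t; case: (u t) (v t) => ? ? [].
Qed.

End ComplexFamily.

End Families.

(** * Real and imaginary parts, and evaluation *)

Section LinearParts.

(** When B is viewed as an algebra over A through iota, pi is A-linear. The examples
are the real and imaginary parts for the embedding of the reals in the complex
numbers, and then their coefficientwise extensions to polynomials. *)
Definition linear_part (A B : comNzRingType) (iota : A -> B) (pi : B -> A) :=
  pi 0 = 0 /\ forall u v t, pi (u * iota t + v) = pi u * t + pi v.

Lemma linear_part_poly (A B : comNzRingType) (iota : {rmorphism A -> B}) pi :
  linear_part iota pi -> linear_part (map_poly iota) (map_poly pi).
Proof.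
move=> [pi0 piL]; split; first by apply/polyP => l; rewrite coef_map_id0 ?coef0.
have piD u v : pi (u + v) = pi u + pi v.
  by rewrite -[u in LHS]mulr1 -(rmorph1 iota) piL mulr1.
have piM u t : pi (u * iota t) = pi u * t.
  by rewrite -[X in pi X]addr0 piL pi0 addr0.
move=> u v t; apply/polyP => l; rewrite coefD coefM !coef_map_id0 // coefD coefM piD.
congr (_ + _); rewrite (big_morph pi piD pi0); apply: eq_bigr => j _.
by rewrite !coef_map_id0 // ?rmorph0 // piM.
Qed.

(** Evaluation at a point of A is an A-linear combination of coefficients, and so
commutes with pi. *)
Lemma horner_linear_part (A B : comNzRingType) (iota : {rmorphism A -> B}) pi
    (q : {poly B}) t :
  linear_part iota pi -> (map_poly pi q).[t] = pi q.[iota t].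
Proof.
move=> [pi0 piL].
have piD u v : pi (u + v) = pi u + pi v.
  by rewrite -[u in LHS]mulr1 -(rmorph1 iota) piL mulr1.
elim/poly_ind: q => [|q c IH].
  rewrite (_ : map_poly pi 0 = 0) ?horner0 ?pi0 //.
  by apply/polyP => l; rewrite coef_map_id0 ?coef0.
rewrite !hornerE piL -IH.
have -> : map_poly pi (q * 'X + c%:P) = map_poly pi q * 'X + (pi c)%:P.
  apply/polyP => l; rewrite coefD coefMX coefC !coef_map_id0 // coefD coefMX coefC.
  by case: l => [|l] /=; rewrite ?add0r ?addr0 ?coef_map_id0.
by rewrite !hornerE.
Qed.

End LinearParts.

Section ComplexLinearParts.
Context (R : rcfType).

Lemma Re_linear_part : linear_part (real_complex R) (@complex.Re R).
Proof.
by split=> // -[u1 u2] [v1 v2] t /=; rewrite mulr0 subr0.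
Qed.

Lemma Im_linear_part : linear_part (real_complex R) (@complex.Im R).
Proof.
by split=> // -[u1 u2] [v1 v2] t /=; rewrite mulr0 add0r.
Qed.

End ComplexLinearParts.

(** The outer variable is evaluated first, at x, and then the inner one at y, as in
[vanishes_on]. *)
Definition eval2 (F : comNzRingType) (x y : F) : {poly {poly F}} -> F :=
  horner_eval y \o horner_eval x%:P.

HB.instance Definition _ (F : comNzRingType) (x y : F) :=
  GRing.RMorphism.copy (eval2 x y) (horner_eval y \o horner_eval x%:P).

Lemma eval2_linear_part (A B : comNzRingType) (iota : {rmorphism A -> B})
    pi c x y :
  linear_part iota pi ->
  eval2 x y (map_poly (map_poly pi) c) = pi (eval2 (iota x) (iota y) c).
Proof.
move=> pL; rewrite /eval2 /= /horner_eval.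
rewrite (horner_linear_part c x%:P (linear_part_poly pL)).
by rewrite (horner_linear_part _ y pL) /= map_polyC.
Qed.

Lemma map_eval2_linear_part (A B : comNzRingType) (iota : {rmorphism A -> B})
    pi q x y :
  linear_part iota pi ->
  map_poly (eval2 x y) (map_poly (map_poly (map_poly pi)) q)
  = map_poly pi (map_poly (eval2 (iota x) (iota y)) q).
Proof.
move=> pL; have [pi0 _] := pL.
have pi10 : map_poly pi 0 = 0 by apply/polyP => l; rewrite coef_map_id0 ?coef0.
have pi20 : map_poly (map_poly pi) 0 = 0.
  by apply/polyP => l; rewrite coef_map_id0 ?coef0.
apply/polyP => l; rewrite coef_map /= (coef_map_id0 _ _ pi20) (coef_map_id0 _ _ pi0).
by rewrite coef_map /=; exact: eval2_linear_part.
Qed.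

Lemma map_divisor (B B' : comNzRingType) (f : {rmorphism B -> B'}) p q :
  map_poly f ('X ^+ p * ('X - 1) ^+ q) = 'X ^+ p * ('X - 1) ^+ q.
Proof. by rewrite rmorphM !rmorphXn rmorphB /= map_polyX rmorph1. Qed.

Lemma map_poly_1subX (B B' : comNzRingType) (f : {rmorphism B -> B'}) :
  map_poly f (1 - 'X) = 1 - 'X.
Proof. by rewrite rmorphB /= map_polyX rmorph1. Qed.

Section EvalCoef.
Context (B : comNzRingType) (x y c u : B).

Lemma eval2_cst : eval2 x y c%:P%:P = c.
Proof. by rewrite /eval2 /= /horner_eval !hornerC. Qed.

Lemma eval2_slopeP : eval2 x y ('X - c%:P%:P) = x - c.
Proof. by rewrite /eval2 /= /horner_eval !hornerE. Qed.

Lemma eval2_slopeR : eval2 x y (u%:P%:P * ('X%:P - c%:P%:P)) = u * (y - c).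
Proof. by rewrite /eval2 /= /horner_eval !hornerE. Qed.

End EvalCoef.

(** * All atoms at the origin *)

Section Special.
Context (F : fieldType) (v : F).
Let w := 1 + v.

(** This is f1 at alpha = beta = 0, x = 1 and v = i y. The roots of the first
polynomial in g are - m, with multiplicity n - 1, and 1 - m; the right-hand side
collects the values of the second one there. *)
Lemma sylvester_det_origin n k : (0 < n)%N -> (0 < k)%N ->
  sylvester_det (k + n) k
    ((1%:P%:P * 'X + 'X%:P) ^+ n.-1 * (1%:P%:P * 'X + 'X%:P - 1))
    ((v%:P%:P * 'X + (1 - 'X)%:P) ^+ k.-1 * (v%:P%:P * 'X + (1 - 'X)%:P - 1)) =
    (-1) ^+ (k * n) * ((1 - w *: 'X) ^+ k.-1 * - (w *: 'X)) ^+ n.-1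
    * ((w *: (1 - 'X)) ^+ k.-1 * (v%:P - w *: 'X)).
Proof.
move=> n0 k0; set p := _ * _; set q := (X in sylvester_det _ _ _ X).
have -> : p = 1 *: \prod_(r <- rcons (nseq n.-1 (- 'X)) (1 - 'X)) ('X - r%:P).
  rewrite scale1r -cats1 big_cat big_seq1 big_nseq iter_mulr_1 /p !mul1r polyCN opprK.
  by congr (_ * _); rewrite polyCB polyC1; ring.
have sr : size (rcons (nseq n.-1 (- 'X)) (1 - 'X) : seq {poly F}) = n.
  by rewrite size_rcons size_nseq prednK.
rewrite -[X in sylvester_det (k + X)%N]sr.
rewrite sylvester_det_roots; last first.
  have sl : (size (v%:P%:P * 'X + (1 - 'X)%:P : {poly {poly F}})%R <= 2)%N.
    by rewrite size_MXaddC; case: ifP => // _; rewrite ltnS size_polyC leq_b1.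
  apply: leq_trans (size_polyMleq _ _) _.
  have sX : (size ((v%:P%:P * 'X + (1 - 'X)%:P : {poly {poly F}}) ^+ k.-1)%R <= k)%N.
    rewrite (leq_trans (size_poly_exp_leq _ _)) // -[X in (_ <= X)%N](prednK k0).
    by rewrite ltnS -[X in (_ <= X)%N]mul1n leq_mul2r; move: (size _) sl => s; lia.
  have s1 : (size (v%:P%:P * 'X + (1 - 'X)%:P - 1 : {poly {poly F}})%R <= 2)%N.
    by rewrite (leq_trans (size_polyD _ _)) // geq_max sl size_polyN size_poly1.
  by move: (size _) (size _) sX s1 => s t; lia.
rewrite expr1n mulr1 sr -mulrA; congr (_ * _).
rewrite -cats1 big_cat big_seq1 big_nseq iter_mulr_1 /=.
have qE z : q.[z] = (v%:P * z + (1 - 'X)) ^+ k.-1 * (v%:P * z + (1 - 'X) - 1).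
  by rewrite /q !hornerE.
rewrite !qE -!mul_polyC /w !polyCD polyC1.
congr (_ ^+ _ * _); congr (_ ^+ _ * _); ring.
Qed.

(** The quotient f2 in factored form; its sign is immaterial, and left
unspecified. *)
Lemma origin_quotient n k (h : {poly F}) : w != 0 -> (0 < n)%N -> (0 < k)%N ->
  h * ('X ^+ n.-1 * ('X - 1) ^+ k.-1) =
    (-1) ^+ (k * n) * ((1 - w *: 'X) ^+ k.-1 * - (w *: 'X)) ^+ n.-1
    * ((w *: (1 - 'X)) ^+ k.-1 * (v%:P - w *: 'X)) ->
  exists s, h = ((-1) ^+ s * w ^+ (n * k))
    *: (('X - w^-1%:P) ^+ (n.-1 * k.-1) * ('X - (v / w)%:P)).
Proof.
case: n k => // n [|k] // w0 _ _; rewrite /= => H.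
have d0 : 'X ^+ n * ('X - 1) ^+ k != 0 :> {poly F}.
  by rewrite mulf_neq0 ?expf_neq0 ?polyX_eq0 // -polyC1 polyXsubC_eq0.
(* With n and k shifted by one, (k+1)(n+1) is the exponent of the sign in H, n
   comes from the factors - w X, k from 1 - X = - (X - 1), and nk + 1 from the
   leading coefficients - w of the factors 1 - w X and v - w X. *)
exists (k.+1 * n.+1 + n + k + n * k + 1)%N; apply: (mulIf d0); rewrite H.
have E1 : 1 - w *: 'X = - w%:P * ('X - w^-1%:P).
  by rewrite mulrBr !mulNr -!polyCM divff // polyC1 mul_polyC; ring.
have E2 : v%:P - w *: 'X = - w%:P * ('X - (v / w)%:P).
  rewrite mulrBr !mulNr -mul_polyC [v / w]mulrC polyCM mulrA -polyCM divff //.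
  by rewrite polyC1; ring.
rewrite E1 E2 -!mul_polyC; move: ('X - w^-1%:P) ('X - (v / w)%:P) => P Q.
rewrite !polyCM !rmorphXn /= polyCN polyC1.
have -> : 1 - 'X = - ('X - 1) :> {poly F} by rewrite opprB.
move: ('X - 1) w%:P => D W.
rewrite !mulNr -(mulN1r (W * P)) -(mulN1r (W * 'X)) -(mulN1r (W * Q)) -(mulN1r D).
rewrite (_ : (n.+1 * k.+1 = k * n + n + k + 1)%N); last by lia.
rewrite [(n * k)%N]mulnC !exprMn -!exprM !exprD !expr1.
move: (-1 : {poly F}) => m1.
move: (m1 ^+ (k * n)) (m1 ^+ n) (m1 ^+ k) (W ^+ (k * n)) (W ^+ n) (W ^+ k).
by move: (P ^+ (k * n)) ('X^n) (D ^+ k) (m1 ^+ (k.+1 * n.+1)) => *; ring.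
Qed.

End Special.

Section Coprime.
Context (R : rcfType).
Local Notation C := R[i].

(** With p and q the real and imaginary parts of h, the polynomials h and its
conjugate are p + i q and p - i q. *)
Lemma root_real_imaginary_parts (h : {poly C}) (z : C) :
    root (map_poly (real_complex R) (map_poly (@complex.Re R) h)) z ->
    root (map_poly (real_complex R) (map_poly (@complex.Im R) h)) z ->
  root h z /\ root h z^*.
Proof.
set p := map_poly _ _; set q := map_poly (real_complex R) _ => /rootP pz /rootP qz.
have Dh : h = p + ('i)%:P * q.
  apply/polyP => l; rewrite coefD coefCM !coef_map /= ?coef_map_id0 //.
  exact: complexE.
have Dh' : map_poly (@conjc R) h = p - ('i)%:P * q.
  apply/polyP => l; rewrite coefB coefCM !coef_map /= ?coef_map_id0 //.
  by case: (h`_l) => x y; simpc.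
split; first by apply/rootP; rewrite Dh hornerD hornerM pz qz mulr0 addr0.
rewrite -complex_root_conj; apply/rootP.
by rewrite Dh' hornerD hornerN hornerM pz qz mulr0 subr0.
Qed.

(** Take a root z = X + i V of z^N = 1 + 2 i and Y = V / X, so that 1 + i Y is a
real multiple of z. The imaginary part of z^4 is 4 X V (X^2 - V^2). It is not zero,
since otherwise (1 + 2 i)^4 = - 7 - 24 i, a power of z^4, would be real. *)
Lemma exists_generic_slope N : (0 < N)%N -> exists Y : R,
  [/\ Y != 0, Y ^+ 2 != 1, complex.Re ((1 +i* Y) ^+ N) != 0
    & complex.Im ((1 +i* Y) ^+ N) != 0].
Proof.
move=> N0; have [z /rootP] : exists z : C, root ('X^N - (1 +i* 2)%:P) z.
  apply/closed_rootP; rewrite size_polyDl size_polyXn ?size_polyN ?size_polyC //.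
    by rewrite eqSS -lt0n.
  by rewrite ltnS (leq_trans (leq_b1 _)).
rewrite !hornerE => /eqP; rewrite subr_eq0 => /eqP zN.
case: z zN => X V zN.
have z4 : (X * V * (X ^+ 2 - V ^+ 2) != 0).
  apply/eqP => E0.
  have : (X +i* V) ^+ 4 = (X ^+ 4 - 6%:R * X ^+ 2 * V ^+ 2 + V ^+ 4)%:C.
    apply/eqP; rewrite eq_complex !exprS expr0; simpc.
    apply/andP; split; apply/eqP; last first.
      rewrite /=; transitivity (4%:R * (X * V * (X ^+ 2 - V ^+ 2))); first by ring.
      by rewrite E0 mulr0.
    by rewrite /=; ring.
  move=> /(congr1 (fun c => c ^+ N)); rewrite exprAC zN -rmorphXn.
  by rewrite !exprS expr0; simpc => -[_] /eqP; rewrite lt_eqF //; lra.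
move: z4; rewrite !mulf_eq0 !negb_or subr_eq0 => /andP[/andP[X0 V0] XV].
have wN : (1 +i* (V / X)) ^+ N = (X^-1 ^+ N)%:C * (1 +i* 2).
  rewrite rmorphXn -zN -exprMn; congr (_ ^+ _); simpc.
  by rewrite mulVf // mulrC.
exists (V / X); split.
- by rewrite mulf_neq0 ?invr_neq0.
- by rewrite expr_div_n; apply: contra XV => /eqP/divr1_eq ->.
- by rewrite wN; simpc; rewrite expf_neq0 // invr_neq0.
- by rewrite wN; simpc; rewrite mulf_neq0 ?expf_neq0 // ?invr_neq0 // pnatr_eq0.
Qed.

(** A common root z of the real and imaginary parts is a root of h together with
its conjugate. So w z and w z^* are in {1, i Y}, that is, w z is in {1, i Y} and
w^* z is in {1, - i Y}; the equality of w (w^* z) and w^* (w z) then forces Y = 0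
or Y^2 = 1 in each of the four cases. *)
Lemma coprime_real_imaginary_parts (Y : R) (kappa : C) e (h : {poly C}) :
    let w := 1 +i* Y in
    Y != 0 -> Y ^+ 2 != 1 -> complex.Re kappa != 0 -> complex.Im kappa != 0 ->
    h = kappa *: (('X - w^-1%:P) ^+ e * ('X - ((0 +i* Y) / w)%:P)) ->
  [/\ complex.Re h`_e.+1 != 0, complex.Im h`_e.+1 != 0 &
      sylvester_det (e.+1 + e.+1) e.+1 (map_poly (@complex.Re R) h)
        (map_poly (@complex.Im R) h) != 0].
Proof.
move=> w Y0 Y1 Rk Ik Dh.
have w0 : w != 0 by rewrite eq_complex /= oner_eq0.
have k0 : kappa != 0 by apply: contraNneq Rk => ->.
set B := _ * _ in Dh.
have mB : B \is monic by rewrite rpredM ?rpredX ?monicXsubC.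
have sB : size B = e.+2.
  by rewrite size_Mmonic ?monic_neq0 ?rpredX ?monicXsubC // size_exp_XsubC
    size_XsubC addn2.
have hD : h`_e.+1 = kappa.
  by rewrite Dh coefZ -[X in B`_X]/(e.+2.-1) -sB -lead_coefE (monicP mB) mulr1.
have sh : (size h <= e.+2)%N by rewrite Dh (leq_trans (size_scale_leq _ _)) ?sB.
rewrite hD; split=> //.
have size_part (pi : C -> R) : pi 0 = 0 -> pi kappa != 0 ->
    size (map_poly pi h) = e.+2.
  move=> pi0 pik; apply: size_coef_neq0; last by rewrite coef_map_id0 // hD.
  by rewrite (leq_trans (size_poly _ _)).
rewrite -resultant_sylvester_det ?size_part //.
rewrite resultant_eq0 -leqNgt; set p := map_poly _ _; set q := map_poly _ _.
rewrite leqNgt; apply/negP => sg.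
have /closed_rootP[z gz] : size (map_poly (real_complex R) (gcdp p q)) != 1%N.
  by rewrite size_map_poly neq_ltn sg orbT.
have [hz hz'] : root h z /\ root h z^*.
  rewrite -dvdp_XsubCl in gz; apply: root_real_imaginary_parts; rewrite -/p -/q.
    by rewrite -dvdp_XsubCl (dvdp_trans gz) // dvdp_map dvdp_gcdl.
  by rewrite -dvdp_XsubCl (dvdp_trans gz) // dvdp_map dvdp_gcdr.
have roots t : root h t -> w * t = 1 \/ w * t = 0 +i* Y.
  rewrite Dh rootZ // rootM => /orP[|]; last first.
    by rewrite root_XsubC => /eqP ->; right; rewrite mulrC divfK.
  case: e {Dh mB sB hD sh size_part sg p q gz} B => [|e] B.
    by rewrite expr0 rootC oner_eq0.
  by rewrite root_exp_XsubC => /eqP ->; left; rewrite divff.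
have E : w * (w^* * z) = w^* * (w * z) by rewrite mulrCA.
have conj_root t : w * z^* = t -> w^* * z = t^*.
  by move=> <-; rewrite rmorphM /= conjcK.
move: E; case: (roots _ hz) => ->; case: (roots _ hz') => /conj_root ->;
  rewrite /w; simpc => -[].
- by move=> YN; move/eqP: Y0; apply; lra.
- by move=> YY; move/eqP: Y1; apply; rewrite expr2.
- by move=> YY; move/eqP: Y1; apply; rewrite expr2.
- by move=> YN; move/eqP: Y0; apply; lra.
Qed.

End Coprime.

(** * Degrees and divisibility of f1 and f2 *)

(** Stated for arbitrary families F and K: over an abstract ring, recognizing the
factors does not involve the structure of iterated polynomials. *)
Lemma secular_eq (B : comNzRingType) n (a c : 'I_n -> B) (w : {poly B})
    (F K : 'I_n -> {poly {poly B}}) :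
    (forall i, F i = (c i)%:P%:P * 'X + w%:P) -> (forall i, K i = (a i)%:P%:P) ->
  \prod_(i < n) F i - \sum_(i < n) K i * \prod_(s < n | s != i) F s
    = secular a c w.
Proof.
move=> FE KE; rewrite /secular; congr (_ - _); first by apply: eq_bigr.
by apply: eq_bigr => i _; rewrite KE; congr (_ * _); apply: eq_bigr.
Qed.

Lemma factor_polyP (B : comNzRingType) (x c : B) :
  'X * (x%:P%:P - c%:P%:P) + 'X%:P = (x - c)%:P%:P * 'X + 'X%:P :> {poly {poly B}}.
Proof. by rewrite mulrC -!polyCB. Qed.

Lemma factor_polyR (B : comNzRingType) (u y c : B) :
  u%:P%:P * 'X * (y%:P%:P - c%:P%:P) + 1 - 'X%:P
  = (u * (y - c))%:P%:P * 'X + (1 - 'X)%:P :> {poly {poly B}}.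
Proof. by rewrite mulrAC -!polyCB -!polyCM -addrA polyCB. Qed.

Lemma divisor_sign (B : comNzRingType) (x e : B) p q :
  x ^+ p * (1 - x) ^+ q * e = e * (-1) ^+ q * (x ^+ p * (x - 1) ^+ q).
Proof.
rewrite -[1 - x]opprB [in LHS]exprNn; move: ((-1) ^+ q) (x ^+ p) ((x - 1) ^+ q) => s y z.
ring.
Qed.

Lemma rmorph_sum_tuple (B B' : comNzRingType) (f : {rmorphism B -> B'}) m
    (t : m.-tuple B) :
  \sum_i tnth t i = 1 -> \sum_i f (tnth t i) = 1.
Proof. by move=> t1; rewrite -rmorph_sum t1 rmorph1. Qed.

Section Algo.
Context (R : realType) (n k : nat) (a : n.-tuple R) (b : k.-tuple R).
Hypotheses (n_gt0 : (0 < n)%N) (k_gt0 : (0 < k)%N).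
Hypotheses (a1 : \sum_(i < n) tnth a i = 1) (b1 : \sum_(j < k) tnth b j = 1).
Local Notation C := R[i].
Local Notation Cxy := {poly {poly C}}.

Definition cst_xy (c : C) : Cxy := c%:P%:P.

(** The coefficients of g in the factors of P and R. *)
Definition slopeP m (alpha : m.-tuple R) i : Cxy :=
  'X - cst_xy (tnth alpha i)%:C.
Definition slopeR m (beta : m.-tuple R) j : Cxy :=
  cst_xy 'i * ('X%:P - cst_xy (tnth beta j)%:C).

Lemma polyP_secular alpha : Defs.polyP a alpha =
  secular (fun i => cst_xy (tnth a i)%:C) (slopeP alpha) 'X.
Proof.
apply: secular_eq => i; last by [].
exact: factor_polyP.
Qed.

Lemma polyR_secular beta : Defs.polyR b beta =
  secular (fun j => cst_xy (tnth b j)%:C) (slopeR beta) (1 - 'X).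
Proof.
apply: secular_eq => i; last by [].
exact: factor_polyR.
Qed.

Lemma sum_cst_xy m (t : m.-tuple R) :
  \sum_i tnth t i = 1 -> \sum_i cst_xy (tnth t i)%:C = 1.
Proof. exact: (rmorph_sum_tuple (polyC \o (polyC \o real_complex R))). Qed.

Lemma size_polyP alpha : size (Defs.polyP a alpha) = n.+1.
Proof.
rewrite polyP_secular size_secular //; first exact: sum_cst_xy.
by apply/prodf_neq0 => i _; rewrite polyXsubC_eq0.
Qed.

Lemma size_polyR beta : size (Defs.polyR b beta) = k.+1.
Proof.
rewrite polyR_secular size_secular //; first exact: sum_cst_xy.
apply/prodf_neq0 => j _; rewrite mulf_neq0 // ?polyC_eq0 ?eq_complex /= ?oner_eq0 ?andbF //.
by rewrite /cst_xy -polyCB polyC_eq0 polyXsubC_eq0.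
Qed.

Lemma poly_f1_sylvester_det alpha beta :
  poly_f1 a alpha b beta
  = sylvester_det (k + n) k (Defs.polyP a alpha) (Defs.polyR b beta).
Proof. exact: resultant_sylvester_det (size_polyP _) (size_polyR _). Qed.

Lemma divisor_monic : divisor R n k \is monic.
Proof. by rewrite rpredM // ?rpredX // ?monicX // -polyC1 monicXsubC. Qed.

(** [sylvester_det_divides] with u = m and v = 1 - m, which are exchanged between P
and R. *)
Lemma poly_f2_divisor alpha beta :
  poly_f1 a alpha b beta = poly_f2 a alpha b beta * divisor R n k.
Proof.
suff [e De] : exists e, poly_f1 a alpha b beta = e * divisor R n k.
  by rewrite /poly_f2 De (Pdiv.IdomainMonic.mulpK divisor_monic).
have u0 : ('X : {poly Cxy}) != 0 by rewrite polyX_eq0.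
have v0 : (1 - 'X : {poly Cxy}) != 0.
  by rewrite -opprB oppr_eq0 -polyC1 polyXsubC_eq0.
have sa := sum_cst_xy a1; have sb := sum_cst_xy b1.
have [||||e De] := @sylvester_det_divides _ n k
  (Defs.polyP a alpha) (Defs.polyR b beta) _ _ u0 v0.
- by move=> l; rewrite polyP_secular; exact: secular_divides.
- by rewrite polyP_secular; exact: secular_divides0.
- by move=> l; rewrite polyR_secular; exact: secular_divides.
- have -> : 'X = 1 - (1 - 'X) :> {poly Cxy} by rewrite subKr.
  by rewrite polyR_secular subKr; exact: secular_divides0.
by exists (e * (-1) ^+ k.-1); rewrite poly_f1_sylvester_det De; exact: divisor_sign.
Qed.

Lemma size_poly_f1 alpha beta : (size (poly_f1 a alpha b beta) <= (n * k).+1)%N.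
Proof.
rewrite poly_f1_sylvester_det; apply: size_sylvester_det => l.
  rewrite polyP_secular; apply: size_coef_secular; rewrite ?size_polyX //.
  exact: sum_cst_xy.
rewrite polyR_secular; apply: size_coef_secular => //; first exact: sum_cst_xy.
by rewrite -opprB size_polyN -polyC1 size_XsubC.
Qed.

(** This is n k - (n - 1) - (k - 1). *)
Definition deg_f2 := (n.-1 * k.-1).+1.

Lemma size_poly_f2 alpha beta : (size (poly_f2 a alpha b beta) <= deg_f2.+1)%N.
Proof.
have sd : size (divisor R n k) = (n.-1 + k.-1).+1.
  rewrite size_monicM ?rpredX ?monicX //; last first.
    by rewrite expf_neq0 // -polyC1 polyXsubC_eq0.
  by rewrite size_polyXn -polyC1 size_exp_XsubC addSn /= addnS.
have := size_poly_f1 alpha beta; rewrite poly_f2_divisor.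
have [->|f0] := eqVneq (poly_f2 a alpha b beta) 0; first by rewrite size_poly0.
rewrite size_Mmonic ?divisor_monic // sd /deg_f2.
move: (size _) n_gt0 k_gt0 => s; case: n => // n'; case: k => // k' _ _ /=; lia.
Qed.

End Algo.

(** * Dependence of f2 and f on the atoms *)

Section Families2.
Context (R : realType) (n k : nat) (a : n.-tuple R) (b : k.-tuple R).
Hypotheses (n_gt0 : (0 < n)%N) (k_gt0 : (0 < k)%N).
Hypotheses (a1 : \sum_(i < n) tnth a i = 1) (b1 : \sum_(j < k) tnth b j = 1).
Local Notation C := R[i].
Local Notation T := (n.-tuple R * k.-tuple R)%type.

Definition param_polyfun : (T -> R) -> Prop := polyfun (@pair_coord R n k).

Lemma param_subring : subring_family param_polyfun.
Proof. by split; [exact: polyfun_cst | exact: polyfunD | exact: polyfunM]. Qed.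

Definition xy_family (V : nzRingType) (Q : (T -> V) -> Prop) :=
  coef_family (coef_family Q).

Lemma xy_family_subring (V : nzRingType) (Q : (T -> V) -> Prop) :
  subring_family Q -> subring_family (xy_family Q).
Proof. by move=> Qr; apply: (coef_subring_family (coef_subring_family Qr)). Qed.

Lemma coef_family_polyC (V : nzRingType) (Q : (T -> V) -> Prop) u :
  subring_family Q -> Q u -> coef_family Q (fun t => (u t)%:P).
Proof.
move=> [Qc _ _] Qu l; under eq_fun do rewrite coefC.
by case: (l == 0%N).
Qed.

Lemma family_secular (V : comNzRingType) (Q : (T -> V) -> Prop) m
    (c : 'I_m -> V) (s : T -> 'I_m -> V) (w : {poly V}) :
    subring_family Q -> (forall i, Q (fun t => s t i)) ->
  coef_family (coef_family Q) (fun t => secular c (s t) w).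
Proof.
move=> Qr Qs; have Q1r := coef_subring_family Qr.
have Q2r := coef_subring_family Q1r; have [Qc QD QM] := Q2r.
have QF i : coef_family (coef_family Q) (fun t => (s t i)%:P%:P * 'X + w%:P).
  apply: (QD (fun t => (s t i)%:P%:P * 'X) (fun=> w%:P)) => //.
  apply: (QM (fun t => (s t i)%:P%:P) (fun=> 'X)) => //.
  exact: (coef_family_polyC Q1r (coef_family_polyC Qr (Qs i))).
have QN := familyN Q2r.
apply: (QD (fun t => \prod_(i < m) _) (fun t => - \sum_(i < m) _)).
  exact: (family_prod Q2r).
apply: QN; apply: (family_sum Q2r) => i; apply: (QM (fun=> _)) => //.
exact: (family_prod Q2r).
Qed.

Lemma coef_family_map (V W : nzRingType) (Q : (T -> V) -> Prop)
    (Q' : (T -> W) -> Prop) (pi : V -> W) :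
  pi 0 = 0 -> (forall u, Q u -> Q' (fun t => pi (u t))) ->
  forall u, coef_family Q u -> coef_family Q' (fun t => map_poly pi (u t)).
Proof.
move=> pi0 QQ' u Qu l; under eq_fun do rewrite coef_map_id0 //.
exact: QQ'.
Qed.

Definition param_complex := complex_family param_polyfun.

Lemma param_complex_subring : subring_family param_complex.
Proof. exact: complex_subring_family param_subring. Qed.

Lemma param_complex_coord i : param_complex (fun t => (pair_coord i t)%:C).
Proof. by split; [exact: polyfun_coord | exact: polyfun_cst]. Qed.

Lemma cst_xy_family i :
  xy_family param_complex (fun t => cst_xy (pair_coord i t)%:C).
Proof.
have Q1r := coef_subring_family param_complex_subring.
exact: (coef_family_polyC Q1r
  (coef_family_polyC param_complex_subring (param_complex_coord i))).
Qed.

Lemma polyP_family :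
  coef_family (coef_family (xy_family param_complex))
    (fun t => Defs.polyP a t.1).
Proof.
under eq_fun do rewrite polyP_secular.
have Qr := xy_family_subring param_complex_subring; have [Qc QD _] := Qr.
apply: (family_secular (s := fun t => slopeP t.1) _ _ Qr) => i.
apply: (QD (fun=> 'X) (fun t => - cst_xy (tnth t.1 i)%:C)) => //.
exact: (familyN Qr (cst_xy_family (inl i))).
Qed.

Lemma polyR_family :
  coef_family (coef_family (xy_family param_complex))
    (fun t => Defs.polyR b t.2).
Proof.
under eq_fun do rewrite polyR_secular.
have Qr := xy_family_subring param_complex_subring; have [Qc QD QM] := Qr.
apply: (family_secular (s := fun t => slopeR t.2) _ _ Qr) => j.
apply: (QM (fun=> cst_xy 'i) (fun t => 'X%:P - cst_xy (tnth t.2 j)%:C)) => //.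
apply: (QD (fun=> 'X%:P) (fun t => - cst_xy (tnth t.2 j)%:C)) => //.
exact: (familyN Qr (cst_xy_family (inr j))).
Qed.

Lemma poly_f2_family :
  coef_family (xy_family param_complex) (fun t => poly_f2 a t.1 b t.2).
Proof.
have Qr := xy_family_subring param_complex_subring.
apply: (@family_divp _ _ _ _ _ (n * k).+1 Qr).
- under eq_fun do rewrite poly_f1_sylvester_det //.
  exact: (family_sylvester_det _ _ (coef_subring_family Qr)
    polyP_family polyR_family).
- exact: divisor_monic.
- by move=> t; exact: size_poly_f1.
Qed.

Lemma part_f2_family (pi : C -> R) : pi 0 = 0 ->
    (forall u, param_complex u -> param_polyfun (fun t => pi (u t))) ->
  coef_family (xy_family param_polyfun)
    (fun t => map_poly (map_poly (map_poly pi)) (poly_f2 a t.1 b t.2)).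
Proof.
move=> pi0 piQ.
have pi10 : map_poly pi 0 = 0 by apply/polyP => l; rewrite coef_map_id0 ?coef0.
have pi20 : map_poly (map_poly pi) 0 = 0.
  by apply/polyP => l; rewrite coef_map_id0 ?coef0.
apply: (coef_family_map pi20 _ poly_f2_family) => u.
by apply: coef_family_map => // {}u; exact: coef_family_map.
Qed.

Lemma Re_f2_family :
  coef_family (xy_family param_polyfun) (fun t => Re_f2 a t.1 b t.2).
Proof. by apply: part_f2_family => // u []. Qed.

Lemma Im_f2_family :
  coef_family (xy_family param_polyfun) (fun t => Im_f2 a t.1 b t.2).
Proof. by apply: part_f2_family => // u []. Qed.

Let D := deg_f2 n k.

(** The value of f wherever Re f2 and Im f2 have their maximal degree, but with a
polynomial dependence on the parameters everywhere. *)
Definition formal_f (t : T) : {poly {poly R}} :=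
  sylvester_det (D + D) D (Re_f2 a t.1 b t.2) (Im_f2 a t.1 b t.2).

Lemma formal_f_family : xy_family param_polyfun formal_f.
Proof.
exact: (family_sylvester_det _ _ (xy_family_subring param_subring)
  Re_f2_family Im_f2_family).
Qed.

(** Some coefficient of u t0 is not zero, and this coefficient is a polynomial
function of the parameter. *)
Lemma ae_param_neq0 (u : T -> {poly {poly R}}) t0 :
  xy_family param_polyfun u -> u t0 != 0 ->
  {ae (lebesgue_tuple R n \x lebesgue_tuple R k)%E, forall t, u t != 0}.
Proof.
move=> Qu u0.
have [l [j ulj]] : exists l j, (u t0)`_l`_j != 0.
  exists (size (u t0)).-1, (size (lead_coef (u t0))).-1.
  by rewrite -lead_coefE -lead_coefE !lead_coef_eq0.
apply: negligibleS (pair_zeros_null (Qu l j) ulj) => t /= /negP.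
by rewrite negbK => /eqP ->; rewrite !coef0.
Qed.

End Families2.

(** * A parameter at which f is not zero, and the points of Omega *)

Section Final.
Context (R : realType) (n k : nat) (a : n.-tuple R) (b : k.-tuple R).
Hypotheses (n_gt0 : (0 < n)%N) (k_gt0 : (0 < k)%N).
Hypotheses (a1 : \sum_(i < n) tnth a i = 1) (b1 : \sum_(j < k) tnth b j = 1).
Local Notation C := R[i].
Local Notation T := (n.-tuple R * k.-tuple R)%type.

Lemma map_Re_f2 alpha beta x y :
  map_poly (eval2 x y) (Re_f2 a alpha b beta) = map_poly (@complex.Re R)
    (map_poly (eval2 x%:C y%:C) (poly_f2 a alpha b beta)).
Proof. exact: map_eval2_linear_part (Re_linear_part R). Qed.

Lemma map_Im_f2 alpha beta x y :
  map_poly (eval2 x y) (Im_f2 a alpha b beta) = map_poly (@complex.Im R)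
    (map_poly (eval2 x%:C y%:C) (poly_f2 a alpha b beta)).
Proof. exact: map_eval2_linear_part (Im_linear_part R). Qed.

Lemma map_f1_divisor alpha beta (x y : C) :
  map_poly (eval2 x y) (poly_f1 a alpha b beta) =
  map_poly (eval2 x y) (poly_f2 a alpha b beta) *
    ('X ^+ n.-1 * ('X - 1) ^+ k.-1).
Proof. by rewrite poly_f2_divisor // rmorphM /= map_divisor. Qed.

Definition origin : T := ([tuple of nseq n 0], [tuple of nseq k 0]).

(** At this parameter all slopes coincide, so that the weights a and b disappear. *)
Lemma f2_origin (Y : R) : exists s,
  map_poly (eval2 1 Y%:C) (poly_f2 a origin.1 b origin.2) =
  ((-1) ^+ s * (1 +i* Y) ^+ (n * k)) *: (('X - (1 +i* Y)^-1%:P) ^+ (n.-1 * k.-1)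
    * ('X - ((0 +i* Y) / (1 +i* Y))%:P)).
Proof.
have w1 : 1 + (0 +i* Y) = 1 +i* Y by simpc.
rewrite -w1; apply: origin_quotient => //; first by rewrite w1 eq_complex /= oner_eq0.
rewrite -map_f1_divisor poly_f1_sylvester_det // map_sylvester_det /=.
rewrite polyP_secular polyR_secular !map_secular.
set aC := _ \o _; set cP := _ \o _; set bC := _ \o _; set cR := _ \o _.
have -> : cP = fun=> 1.
  by apply/funext => i; rewrite /cP /= eval2_slopeP /origin /= tnth_nseq subr0.
have -> : cR = fun=> 0 +i* Y.
  by apply/funext => i; rewrite /cR /= eval2_slopeR /origin /= tnth_nseq subr0; simpc.
have sum1 m (t : m.-tuple R) : \sum_i tnth t i = 1 ->
    \sum_i eval2 1 Y%:C (cst_xy (tnth t i)%:C) = 1.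
  move=> t1; under eq_bigr do rewrite eval2_cst.
  exact: (rmorph_sum_tuple (real_complex R)).
rewrite !secular_const ?sum1 // map_polyX map_poly_1subX.
exact: sylvester_det_origin.
Qed.

Let D := deg_f2 n k.

Lemma origin_neq0 :
  [/\ (Re_f2 a origin.1 b origin.2)`_D != 0,
      (Im_f2 a origin.1 b origin.2)`_D != 0 & formal_f a b origin != 0].
Proof.
have nk0 : (0 < n * k)%N by rewrite muln_gt0 n_gt0.
have [Y [Y0 Y1 ReY ImY]] := exists_generic_slope R nk0.
have [s Dh] := f2_origin Y; set h := map_poly _ _ in Dh.
have ReM (z : C) : complex.Re ((-1) ^+ s * z) = (-1) ^+ s * complex.Re z.
  rewrite -!(signr_odd _ s); case: (odd s) => /=;
    by rewrite ?expr1 ?expr0 !(mulN1r, mul1r); case: z.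
have ImM (z : C) : complex.Im ((-1) ^+ s * z) = (-1) ^+ s * complex.Im z.
  rewrite -!(signr_odd _ s); case: (odd s) => /=;
    by rewrite ?expr1 ?expr0 !(mulN1r, mul1r); case: z.
have [||hR hI hS] := coprime_real_imaginary_parts Y0 Y1 _ _ Dh.
- by rewrite ReM mulf_neq0 ?signr_eq0.
- by rewrite ImM mulf_neq0 ?signr_eq0.
have ER : map_poly (eval2 1 Y) (Re_f2 a origin.1 b origin.2)
    = map_poly (@complex.Re R) h := map_Re_f2 _ _ _ _.
have EI : map_poly (eval2 1 Y) (Im_f2 a origin.1 b origin.2)
    = map_poly (@complex.Im R) h := map_Im_f2 _ _ _ _.
split.
- apply: contraNneq hR => z; have := congr1 (fun q : {poly R} => q`_D) ER.
  by rewrite coef_map z raddf0 coef_map_id0 // => <-.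
- apply: contraNneq hI => z; have := congr1 (fun q : {poly R} => q`_D) EI.
  by rewrite coef_map z raddf0 coef_map_id0 // => <-.
- apply: contraNneq hS => z; have := congr1 (eval2 1 Y) z.
  by rewrite rmorph0 /formal_f map_sylvester_det /= ER EI => <-.
Qed.

(** If mu = 0 the value of the Cauchy transform is real, even at a pole, since 0 is
the inverse of 0; so mu is not 0. The denominators do not vanish, since their
imaginary part is x - t_i times that of g, and their value is mu if x = t_i. *)
Lemma secular_equation m (c : m.-tuple R) (x mu : R) (t : m.-tuple R) (g : C) :
    complex.Im g != 0 -> cauchy_transform c t (x%:C + mu%:C / g) = g ->
  [/\ mu != 0, forall i, (x - tnth t i)%:C * g + mu%:C != 0 &
      \sum_i (tnth c i)%:C / ((x - tnth t i)%:C * g + mu%:C) = 1].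
Proof.
move=> Ig E.
have g0 : g != 0 by apply: contraNneq Ig => ->.
have mu0 : mu != 0.
  apply: contraNneq Ig => mu0; rewrite -E mu0 mul0r addr0 /cauchy_transform.
  under eq_bigr do rewrite -rmorphB -fmorph_div.
  by rewrite -rmorph_sum.
have nz i : (x - tnth t i)%:C * g + mu%:C != 0.
  case: g Ig {E g0} => g1 g2 /= Ig; apply/eqP; simpc => -[E1 /eqP].
  rewrite mulf_eq0 (negPf Ig) orbF => /eqP E2.
  by move: E1; rewrite E2 mul0r add0r => /eqP; rewrite (negPf mu0).
split=> //; rewrite -[RHS](divff g0) -[X in _ = X / g]E /cauchy_transform mulr_suml.
apply: eq_bigr => i _; rewrite -mulrA -invfM; congr (_ / _).
by rewrite mulrBl mulrDl divfK // rmorphB /=; ring.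
Qed.

(** The equation for G_q is the one for G_p with i g, y and 1 - m in place of g, x
and m. *)
Lemma f2_vanishes alpha beta z : Omega a alpha b beta z ->
  exists mu : R, (map_poly (eval2 (complex.Re z)%:C (complex.Im z)%:C)
    (poly_f2 a alpha b beta)).[mu%:C] = 0.
Proof.
move=> [g [mu [Ig Rg EP ER]]]; exists mu.
have [mu0 nzP sP] := secular_equation Ig EP.
have Iig : complex.Im ('i * g) != 0 by case: (g) Rg => g1 g2; simpc.
have [mu1 nzR sR] := secular_equation Iig ER.
set x := complex.Re z in EP nzP sP *; set y := complex.Im z in ER nzR sR *.
pose psi : {rmorphism {poly {poly {poly C}}} -> C} :=
  horner_eval (mu%:C) \o map_poly (eval2 x%:C y%:C).
have psiC (c : {poly {poly C}}) : psi c%:P = eval2 x%:C y%:C c.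
  by rewrite /psi /= map_polyC /horner_eval hornerC.
have psiX : psi 'X = mu%:C by rewrite /psi /= map_polyX /horner_eval hornerX.
have psi1X : psi (1 - 'X) = (1 - mu)%:C.
  by rewrite /psi /= map_poly_1subX /horner_eval !hornerE rmorphB.
have slopeE i : psi (slopeP alpha i)%:P = (x - tnth alpha i)%:C.
  by rewrite psiC eval2_slopeP rmorphB.
have slopeRE j : psi (slopeR beta j)%:P = 'i * (y - tnth beta j)%:C.
  by rewrite psiC eval2_slopeR rmorphB.
have f10 : psi (poly_f1 a alpha b beta) = 0.
  apply: (resultant_common_root (f := psi) (g := g)); rewrite ?size_polyP ?size_polyR //.
    rewrite polyP_secular; apply: secular_root => [i|]; first by rewrite slopeE psiX.
    rewrite -[RHS]sP; apply: eq_bigr => i _.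
    by rewrite slopeE psiX psiC eval2_cst.
  rewrite polyR_secular; apply: secular_root => [j|].
    by rewrite slopeRE psi1X -mulrA mulrCA.
  rewrite -[RHS]sR; apply: eq_bigr => j _.
  by rewrite slopeRE psi1X psiC eval2_cst -mulrA mulrCA.
move: f10; rewrite /psi /= map_f1_divisor /horner_eval hornerM => /eqP.
rewrite mulf_eq0 => /orP[/eqP //|]; rewrite !hornerE mulf_eq0 !expf_eq0.
rewrite -(rmorph1 (real_complex R)) -rmorphB /= !(fmorph_eq0 (real_complex R)).
by rewrite (negPf mu0) subr_eq0 [mu == 1]eq_sym -subr_eq0 (negPf mu1) !andbF.
Qed.

Lemma poly_f_vanishes alpha beta :
    (1 < size (Re_f2 a alpha b beta))%N -> (1 < size (Im_f2 a alpha b beta))%N ->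
  vanishes_on (poly_f a alpha b beta) (Omega a alpha b beta).
Proof.
move=> sR sI z /f2_vanishes[mu h0].
rewrite -[LHS]/(eval2 (complex.Re z) (complex.Im z)
  (resultant (Re_f2 a alpha b beta) (Im_f2 a alpha b beta))).
apply: (resultant_common_root (g := mu) sR sI).
  by rewrite map_Re_f2 (horner_linear_part _ _ (Re_linear_part R)) h0.
by rewrite map_Im_f2 (horner_linear_part _ _ (Im_linear_part R)) h0.
Qed.

End Final.

Local Close Scope complex_scope.

Theorem theorem6p3 (R : realType) (n k : nat) (a : n.-tuple R) (b : k.-tuple R)
    (n_ge1 : (1 <= n)%N) (k_ge1 : (1 <= k)%N)
    (a_ge0 : forall i : 'I_n, 0 <= tnth a i)
    (b_ge0 : forall j : 'I_k, 0 <= tnth b j)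
    (a_sum1 : \sum_(i < n) tnth a i = 1)
    (b_sum1 : \sum_(j < k) tnth b j = 1) :
  {ae (lebesgue_tuple R n \x lebesgue_tuple R k)%E,
    forall ab : n.-tuple R * k.-tuple R,
      let alpha := ab.1 in let beta := ab.2 in
      (exists f : {poly {poly R}},
        f != 0 /\ vanishes_on f (Omega a alpha b beta)) /\
      [/\ poly_f1 a alpha b beta
            = poly_f2 a alpha b beta * divisor R n k,
          poly_f a alpha b beta != 0 &
          vanishes_on (poly_f a alpha b beta) (Omega a alpha b beta)]}.
Proof.
have [oR oI oF] := origin_neq0 n_ge1 k_ge1 a_sum1 b_sum1.
have [_ _ QM] := xy_family_subring (param_subring R n k).
have Qu := QM _ _ (QM _ _ (Re_f2_family n_ge1 k_ge1 a_sum1 b_sum1 (deg_f2 n k))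
  (Im_f2_family n_ge1 k_ge1 a_sum1 b_sum1 (deg_f2 n k)))
  (formal_f_family n_ge1 k_ge1 a_sum1 b_sum1).
have := ae_param_neq0 Qu (mulf_neq0 (mulf_neq0 oR oI) oF).
apply: negligibleS => -[alpha beta] /=; apply: contra_not => /=.
rewrite !mulf_eq0 !negb_or -andbA => /and3P[hR hI hF].
have sR : size (Re_f2 a alpha b beta) = (deg_f2 n k).+1.
  by apply: size_coef_neq0 => //; rewrite (leq_trans (size_poly _ _)) // size_poly_f2.
have sI : size (Im_f2 a alpha b beta) = (deg_f2 n k).+1.
  by apply: size_coef_neq0 => //; rewrite (leq_trans (size_poly _ _)) // size_poly_f2.
have f0 : poly_f a alpha b beta != 0 by rewrite /poly_f (resultant_sylvester_det sR sI).
have fV : vanishes_on (poly_f a alpha b beta) (Omega a alpha b beta).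
  by apply: poly_f_vanishes; rewrite ?sR ?sI.
split; first by exists (poly_f a alpha b beta).
by split=> //; exact: poly_f2_divisor.
Qed.
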